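(* Let $n\ge 2$, $0\le\alpha<1$, $\mu\ge 0$ and $$1<p\le p_F'(n,\alpha)=1+\frac{1+\alpha}{(n+1)(1-\alpha)} .$$ Assume that $u_0\in C^2(\mathbb{R}^n)$ and $u_1\in C^1(\mathbb{R}^n)$ are nonnegative, nontrivial and $\operatorname{supp}u_0,\ \operatorname{supp}u_1\subset\{|x|\le R\}$ with $R>0$. Suppose that the Cauchy problem $$u_{tt}-\frac{1}{t^{2\alpha}}\Delta u+\frac{\mu}{t}u_t=|\nabla_x u|^p,\quad t>1,\ x\in\mathbb{R}^n,\qquad u(1,x)=\varepsilon u_0(x),\quad u_t(1,x)=\varepsilon u_1(x),\quad x\in\mathbb{R}^n,$$ has a classical solution $u\in C^2([1,T)\times\mathbb{R}^n)$. Then $T<\infty$, and there exists a constant $\varepsilon_0>0$ depending on $p,\alpha,\mu,R,u_0,u_1$ such that the lifespan $T_\varepsilon$ has to satisfy $$T_\varepsilon\le C\varepsilon^{-\frac{p-1}{2-\{n(p-1)+p\}(1-\alpha)}}\quad\text{if }p<p_F'(n,\alpha),$$ $$T_\varepsilon\le\exp\left(C\varepsilon^{-p(p-1)/(p+1)}\right)\quad\text{if }p=p_F'(n,\alpha)\text{ and }0\le\mu\le 1,$$ $$T_\varepsilon\le\exp\left(C\varepsilon^{-(p-1)}\right)\quad\text{if }p=p_F'(n,\alpha)\text{ and }\mu>1$$ for $0<\varepsilon\le\varepsilon_0$, where $C>0$ is a constant independent of $\varepsilon$.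
   Context: Here $\Delta=\sum_{j=1}^n\partial^2/\partial x_j^2$, $\nabla_x u=(\partial u/\partial x_1,\dots,\partial u/\partial x_n)$ and $\varepsilon>0$ is a small parameter. The lifespan $T_\varepsilon$ is the supremum of all $T$ such that the Cauchy problem has a solution for $x\in\mathbb{R}^n$ and $1\le t<T$. *)

(* Defs.v *)
From mathcomp Require Import all_boot all_order all_algebra.
From mathcomp Require Import all_classical all_reals all_analysis.
Set Implicit Arguments.
Unset Strict Implicit.
Unset Printing Implicit Defensive.
Import Order.TTheory GRing.Theory Num.Theory.
Import numFieldNormedType.Exports.
Local Open Scope classical_set_scope.
Local Open Scope ring_scope.

(* A point x of R^n is a row vector 'rV[R]_n. The library
   norm `|x| on 'rV[R]_n is the sup norm (it only fixes the topology here), so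
   the Euclidean norm is defined separately. A function u(t, x) is curried as
   u : R -> 'rV[R]_n -> R. *)

Definition enorm (R : realType) (n : nat) (x : 'rV[R]_n) : R :=
  Num.sqrt (\sum_(i < n) x 0 i ^+ 2).

Definition basis_vec (R : realType) (n : nat) (i : 'I_n) : 'rV[R]_n :=
  delta_mx 0 i.

Definition partial (R : realType) (n : nat) (i : 'I_n) (f : 'rV[R]_n -> R) :
    'rV[R]_n -> R :=
  fun x => 'D_(basis_vec R i) f x.

Definition gradient (R : realType) (n : nat) (f : 'rV[R]_n -> R)
    (x : 'rV[R]_n) : 'rV[R]_n :=
  \row_(i < n) partial i f x.

Definition laplacian (R : realType) (n : nat) (f : 'rV[R]_n -> R)
    (x : 'rV[R]_n) : R :=
  \sum_(i < n) partial i (partial i f) x.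

Fixpoint Ck (R : realType) (n k : nat) (f : 'rV[R]_n -> R) : Prop :=
  match k with
  | 0 => continuous f
  | k'.+1 => [/\ continuous f,
      forall x i, derivable f x (basis_vec R i) &
      forall i, Ck k' (partial i f)]
  end.

Definition tsupp (R : realType) (n : nat) (f : 'rV[R]_n -> R) :
    set 'rV[R]_n :=
  closure [set x | f x != 0].

(* Time derivatives are taken relative to [1, +oo[: two-sided for t > 1,
   one-sided from the right at t = 1. *)
Definition time_quot (R : realType) (n : nat) (u : R -> 'rV[R]_n -> R)
    (t : R) (x : 'rV[R]_n) (h : R) : R :=
  h^-1 * (u (t + h) x - u t x).

Definition time_filter (R : realType) (t : R) : set_system R :=
  within [set h : R | 1 <= t + h] 0^'.

Definition time_derivable (R : realType) (n : nat) (u : R -> 'rV[R]_n -> R)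
    (t : R) (x : 'rV[R]_n) : Prop :=
  cvg (time_quot u t x @ time_filter t).

Definition time_derive (R : realType) (n : nat) (u : R -> 'rV[R]_n -> R) :
    R -> 'rV[R]_n -> R :=
  fun t x => lim (time_quot u t x @ time_filter t).

Definition space_partial (R : realType) (n : nat) (i : 'I_n)
    (u : R -> 'rV[R]_n -> R) : R -> 'rV[R]_n -> R :=
  fun t => partial i (u t).

(* [1, T[ x R^n, with T possibly +oo *)
Definition slab (R : realType) (n : nat) (T : \bar R) : set (R * 'rV[R]_n) :=
  [set z | 1 <= z.1 /\ (z.1%:E < T)%E].
Arguments slab {R} n T.

(* u is of class C^k on [1, T[ x R^n, up to the boundary t = 1 *)
Fixpoint slab_Ck (R : realType) (n k : nat) (T : \bar R)
    (u : R -> 'rV[R]_n -> R) : Prop :=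
  match k with
  | 0 => {within slab n T, continuous (fun z : R * 'rV[R]_n => u z.1 z.2)}
  | k'.+1 =>
    [/\ {within slab n T, continuous (fun z : R * 'rV[R]_n => u z.1 z.2)},
        forall (t : R) (x : 'rV[R]_n), slab n T (t, x) ->
          time_derivable u t x,
        forall (t : R) (x : 'rV[R]_n) (i : 'I_n), slab n T (t, x) ->
          derivable (u t) x (basis_vec R i),
        slab_Ck k' T (time_derive u) &
        forall i, slab_Ck k' T (space_partial i u)]
  end.

Definition classical_solution (R : realType) (n : nat) (alpha mu p : R)
    (u0 u1 : 'rV[R]_n -> R) (eps : R) (T : \bar R)
    (u : R -> 'rV[R]_n -> R) : Prop :=
  [/\ slab_Ck 2 T u,
      forall (t : R) (x : 'rV[R]_n), 1 < t -> (t%:E < T)%E ->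
        time_derive (time_derive u) t x
          - (t `^ (2 * alpha))^-1 * laplacian (u t) x
          + mu / t * time_derive u t x
        = enorm (gradient (u t) x) `^ p,
      forall x : 'rV[R]_n, u 1 x = eps * u0 x &
      forall x : 'rV[R]_n, time_derive u 1 x = eps * u1 x].

(* The value is -oo when there is no solution on any [1, T[ with T > 1. *)
Definition lifespan (R : realType) (n : nat) (alpha mu p : R)
    (u0 u1 : 'rV[R]_n -> R) (eps : R) : \bar R :=
  ereal_sup [set T : \bar R | (1%:E < T)%E /\
    exists u, classical_solution alpha mu p u0 u1 eps T u].

Definition pF' (R : realType) (n : nat) (alpha : R) : R :=
  1 + (1 + alpha) / (n.+1%:R * (1 - alpha)).

(* Main.v *)
Require Import Defs.
From mathcomp Require Import all_boot all_order all_algebra.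
From mathcomp Require Import all_classical all_reals all_analysis.
From mathcomp Require Import ring lra.
Import Order.TTheory GRing.Theory Num.Theory.
Import numFieldNormedType.Exports.
Local Open Scope classical_set_scope.
Local Open Scope ring_scope.
Set Implicit Arguments.
Unset Strict Implicit.
Unset Printing Implicit Defensive.

(** The proof follows the spatial mean F(t) of u(t, .).

    Waves in this equation travel at speed t^(-alpha), hence between the times 1
    and t over the distance A(t) = (t^(1 - alpha) - 1) / (1 - alpha): a solution
    vanishes at every point with a coordinate larger than r + A(t) in absolute
    value ([finite_propagation_speed]).  Integrating the equation over a box that
    contains the support removes the Laplacian:
      F'' + (mu / t) F' = integral of |grad u|^p.
    For the same reason F equals the integral of - (x_i - y_i) d_i u, so F is at
    most l times the integral of |grad u|, where l is half the side of the box.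
    By convexity (Jensen on a box of volume (2 l)^n, [mean_jensen]) the right-hand
    side is at least a constant times l^(-(n (p - 1) + p)) F^p, and l grows like
    t^(1 - alpha).  This gives [spatial_mean_inequality]:
      F'' + (mu / t) F' >= c t^(-q) F^p,   q = (n (p - 1) + p) (1 - alpha),
    where F(1) is a positive multiple of eps, and F' >= 0 because t^mu F' increases.

    In the variable s = ln t, G(s) = F(e^s) satisfies
      G'' + (mu - 1) G' >= c e^(delta s) G^p,   delta = 2 - q.
    Here delta = (n + 1) (1 - alpha) (pF' - p), so delta >= 0 is the assumption on p.
    A function with G'' + kappa G' >= k G^p grows from f to 2 f within the time
    2 rho + 4 kappa rho^2, where k f^(p - 1) rho^2 = 1 ([solution_doubles]); these
    times form a convergent geometric series, which bounds the existence time
    ([blowup_time_bound]).  Starting at s0, where k = c e^(delta s0), with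
    f = eps a, the logarithm of the lifespan is at most
      s0 + k1 g + k2 kappa g^2,   g = eps^(-(p - 1) / 2) e^(-delta s0 / 2)
    ([existence_time_bound]).  If delta > 0, the choice of s0 that makes g = 1
    gives the power law.  If delta = 0, take s0 = 0: for mu <= 1 one may choose
    kappa = 0 and only eps^(-(p - 1) / 2) remains, which for eps <= 1 is below the
    stated power; for mu > 1 the term eps^(-(p - 1)) dominates.

    Finite propagation speed comes from a weighted energy on a backward cone.  The
    weight is the square of the positive part of D(t)^2 - |x - x0|^2, where the
    radius D shrinks at the speed of the waves; this weight is C^1, so all
    integrals are over one fixed box.  Where the gradient is bounded, the source
    |grad u|^p is at most a constant times |grad u|, and Gronwall's inequality
    makes an initially zero energy stay zero.

    Box integrals are iterated one-dimensional integrals along coordinate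
    directions of space-time, so that dominated convergence and the fundamental
    theorem of calculus on a segment are the only analytic facts on integrals involved.
    The equality of mixed derivatives is also proved through such integrals. *)

(** * Integrals over a symmetric segment *)

Definition seg_int (R : realType) (L : R) (g : R -> R) : R :=
  \int[@lebesgue_measure R]_(s in `[- L, L]) g s.

Lemma seg_integrable (R : realType) (L : R) (g : R -> R) :
  continuous g ->
  (@lebesgue_measure R).-integrable `[- L, L] (EFin \o g).
Proof.
move=> cg; apply: continuous_compact_integrable; first exact: segment_compact.
exact: continuous_subspaceT.
Qed.

Lemma seg_int_le (R : realType) (L : R) (g1 g2 : R -> R) :
  continuous g1 -> continuous g2 ->
  (forall s, - L <= s <= L -> g1 s <= g2 s) -> seg_int L g1 <= seg_int L g2.
Proof.
move=> c1 c2 g12; apply: le_Rintegral => //.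
1,2: exact: seg_integrable.
Qed.

Lemma seg_int_eq (R : realType) (L : R) (g1 g2 : R -> R) :
  (forall s, - L <= s <= L -> g1 s = g2 s) -> seg_int L g1 = seg_int L g2.
Proof.
move=> g12; apply: eq_Rintegral => s; rewrite inE/= in_itv/=; exact: g12.
Qed.

Lemma seg_intD (R : realType) (L : R) (g1 g2 : R -> R) :
  continuous g1 -> continuous g2 ->
  seg_int L (fun s => g1 s + g2 s) = seg_int L g1 + seg_int L g2.
Proof. by move=> c1 c2; apply: RintegralD => //; exact: seg_integrable. Qed.

Lemma seg_intZ (R : realType) (L k : R) (g : R -> R) :
  continuous g -> seg_int L (fun s => k * g s) = k * seg_int L g.
Proof. by move=> c1; apply: RintegralZl => //; exact: seg_integrable. Qed.

Lemma seg_int_cst (R : realType) (L k : R) :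
  0 <= L -> seg_int L (fun=> k) = k * (2 * L).
Proof.
move=> L0; rewrite /seg_int Rintegral_cst//; have /= -> := lebesgue_measure_itv `[- L, L]; rewrite lte_fin.
case: ifPn => [_|]; first by rewrite -EFinD/=; congr (_ * _); ring.
rewrite -leNgt => h; have -> : L = 0 by lra.
by rewrite !mulr0.
Qed.

Lemma seg_int_FTC (R : realType) (L : R) (F f : R -> R) : 0 < L ->
  (forall s : R, is_derive s 1 F (f s)) -> continuous f ->
  seg_int L f = F L - F (- L).
Proof.
move=> L0 dF cf; rewrite /seg_int /Rintegral.
have cF s : {for s, continuous F}.
  by apply/differentiable_continuous/derivable1_diffP; case: (dF s).
rewrite (@continuous_FTC2 _ _ F)//; first by lra.
- exact: continuous_subspaceT.
- split; first by move=> x _; case: (dF x).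
  + exact: cvg_at_right_filter (cF _).
  + exact: cvg_at_left_filter (cF _).
- by move=> x _; rewrite derive1E; case: (dF x).
Qed.

(** This allows the integration domain to follow the support. *)
Lemma seg_int_shrink (R : realType) (L L' : R) (f : R -> R) : L <= L' ->
  (forall s, L < `|s| -> f s = 0) -> seg_int L' f = seg_int L f.
Proof.
move=> LL' f0; rewrite /seg_int Rintegral_mkcond [RHS]Rintegral_mkcond.
apply: eq_Rintegral => s _; rewrite !patchE !mem_setE !in_itv/=.
case: (leP `|s| L) => h.
  have : - L <= s <= L by rewrite -ler_norml.
  by move=> /andP[a b]; rewrite !ifT//; apply/andP; split; lra.
by rewrite f0//; do 2 case: ifP.
Qed.

Lemma seg_int_subset (R : realType) (L L' : R) (f : R -> R) : L <= L' ->
  continuous f -> (forall s, 0 <= f s) -> seg_int L f <= seg_int L' f.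
Proof.
move=> LL' cf f0; apply: fine_le.
- exact: integrable_fin_num (seg_integrable _ _).
- exact: integrable_fin_num (seg_integrable _ _).
- apply: ge0_subset_integral => //.
  + case/integrableP: (seg_integrable L' cf) => mf _; exact: mf.
  + by move=> x _; rewrite lee_fin.
  + by apply: subset_itv; rewrite bnd_simp; lra.
Qed.

(** A nonnegative continuous function with a positive value at the centre has
    a positive integral; the boxes below are always centred at the point of
    interest, so the value at the centre is all that has to be recovered. *)
Lemma seg_int_eq0 (R : realType) (L : R) (f : R -> R) : 0 < L ->
  continuous f -> (forall s, 0 <= f s) -> seg_int L f = 0 -> f 0 = 0.
Proof.
move=> L0 cf f0 If; apply/eqP/negPn/negP => fn0.
have fp : 0 < f 0 by rewrite lt_def fn0 f0.
have /cvgrPdist_lt/(_ (f 0 / 2)) := cf 0.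
move=> /(_ ltac:(lra))/nbhs_ballP[d /= d0 db].
(* f >= f 0 / 2 on [-e, e] *)
pose e := Num.min (d / 2) L.
have e0 : 0 < e by rewrite lt_min L0 andbT; lra.
have ed : e <= d / 2 by rewrite ge_min lexx.
have eL : e <= L by rewrite ge_min lexx orbT.
have : seg_int e (fun=> f 0 / 2) <= seg_int L f.
  apply: le_trans (seg_int_subset eL cf f0).
  apply: seg_int_le => //; first by move=> ?; exact: cvg_cst.
  move=> s /andP[s1 s2].
  have : ball 0 d s.
    by rewrite -ball_normE /ball_ /= sub0r normrN ltr_norml; apply/andP; split; lra.
  by move=> /db /=; rewrite ltr_norml => /andP[]; lra.
rewrite If seg_int_cst; last exact: ltW.
by rewrite leNgt => /negP; apply; rewrite mulr_gt0//; lra.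
Qed.

(** * Continuity and differentiation of explicit expressions *)

Section Continuity.
Context {R : realType} {T : topologicalType} {V : normedModType R}.

Lemma continuous_addf (f g : T -> V) : continuous f -> continuous g ->
  continuous (fun x => f x + g x).
Proof. by move=> cf cg x; apply: cvgD; [exact: cf|exact: cg]. Qed.

Lemma continuous_subf (f g : T -> V) : continuous f -> continuous g ->
  continuous (fun x => f x - g x).
Proof. by move=> cf cg x; apply: cvgB; [exact: cf|exact: cg]. Qed.

Lemma continuous_scalef (f : T -> R) (g : T -> V) :
  continuous f -> continuous g -> continuous (fun x => f x *: g x).
Proof. by move=> cf cg x; apply: cvgZ; [exact: cf|exact: cg]. Qed.

Lemma continuous_mulf (f g : T -> R) : continuous f -> continuous g ->
  continuous (fun x => f x * g x).
Proof. by move=> cf cg x; apply: cvgM; [exact: cf|exact: cg]. Qed.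

Lemma continuous_expf (f : T -> R) (m : nat) : continuous f ->
  continuous (fun x => f x ^+ m).
Proof.
move=> cf; elim: m => [|m ih]; first by move=> x; exact: cvg_cst.
under eq_fun do rewrite exprS; exact: continuous_mulf.
Qed.

Lemma continuous_sumf (I : Type) (l : seq I) (P : pred I) (f : I -> T -> V) :
  (forall i, continuous (f i)) ->
  continuous (fun x => \sum_(i <- l | P i) f i x).
Proof.
move=> cf; elim: l => [|i l ih].
  by under eq_fun do rewrite big_nil; move=> x; exact: cvg_cst.
under eq_fun do rewrite big_cons.
by case: (P i) => //; exact: continuous_addf.
Qed.

Lemma continuous_compf (U W : topologicalType) (f : T -> U) (g : U -> W) :
  continuous f -> continuous g -> continuous (fun x => g (f x)).
Proof. by move=> cf cg x; apply: continuous_comp; [exact: cf|exact: cg]. Qed.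

Lemma continuous_cst (U : topologicalType) (c : U) :
  continuous (fun _ : T => c).
Proof. by move=> x; exact: cvg_cst. Qed.

Lemma continuous_bounded_on_compact (g : T -> R) (K : set T) :
  compact K -> continuous g -> exists2 M, 0 < M & forall x, K x -> `|g x| <= M.
Proof.
move=> cK cg; have [->|K0] := eqVneq K set0; first by exists 1.
have cng : continuous (fun x => `|g x|).
  by move=> x; apply: cvg_norm; exact: cg.
have [c _ cmax] := @compact_EVT_max T R (fun x => `|g x|) K
  (proj1 (set0P _) K0) cK (continuous_subspaceT cng).
exists (`|g c| + 1); first by rewrite ltr_wpDl.
by move=> x Kx; rewrite (le_trans (cmax x _)) ?lerDl// inE.
Qed.

End Continuity.

Section PointwiseDerivatives.
Context {R : realType} {V : normedModType R}.
Implicit Types (f g : V -> R) (x v : V).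

Lemma is_derive_addf f g x v df dg : is_derive x v f df -> is_derive x v g dg ->
  is_derive x v (fun y => f y + g y) (df + dg).
Proof. exact: is_deriveD. Qed.

Lemma is_derive_subf f g x v df dg : is_derive x v f df -> is_derive x v g dg ->
  is_derive x v (fun y => f y - g y) (df - dg).
Proof. exact: is_deriveB. Qed.

Lemma is_derive_mulf f g x v df dg : is_derive x v f df -> is_derive x v g dg ->
  is_derive x v (fun y => f y * g y) (f x * dg + df * g x).
Proof.
move=> df' dg'; apply: (is_derive_eq (is_deriveM df' dg')).
by rewrite /GRing.scale/= (mulrC (g x)).
Qed.

Lemma is_derive_cstM (k : R) f x v df : is_derive x v f df ->
  is_derive x v (fun y => k * f y) (k * df).
Proof. by move=> df'; exact: (is_deriveZ k df'). Qed.

Lemma is_derive_sqrf f x v df : is_derive x v f df ->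
  is_derive x v (fun y => f y ^+ 2) (2 * f x * df).
Proof.
move=> df'; apply: is_derive_eq (is_derive_mulf df' df') _.
by rewrite (mulrC df) -mulrA mulr_natl mulr2n.
Qed.

Lemma is_derive_sumf m (h : 'I_m -> V -> R) x v (dh : 'I_m -> R) :
  (forall i, is_derive x v (h i) (dh i)) ->
  is_derive x v (fun y => \sum_(i < m) h i y) (\sum_(i < m) dh i).
Proof.
move=> dhi; have := is_derive_sum dhi.
by congr is_derive; apply/funext => y; rewrite fct_sumE.
Qed.

End PointwiseDerivatives.

(** * Integrals along a direction *)

Section LineIntegral.
Context {R : realType} {V : normedModType R}.
Implicit Types (f : V -> R) (L : R) (v w z : V).

Definition line_int L v f z : R := seg_int L (fun s => f (z + s *: v)).

Lemma continuous_line v z : continuous (fun s : R => z + s *: v).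
Proof.
apply: continuous_addf; first exact: continuous_cst.
by apply: continuous_scalef; [move=> s; exact: cvg_id|exact: continuous_cst].
Qed.

Lemma continuous_on_line f v z : continuous f ->
  continuous (fun s : R => f (z + s *: v)).
Proof. by apply: continuous_compf; exact: continuous_line. Qed.

(** By compactness of [-L, L], f (z + s v) is close to f (z0 + s v) uniformly in s
    for z near z0. *)
Lemma continuous_line_int L v f : 0 < L -> continuous f ->
  continuous (line_int L v f).
Proof.
move=> L0 cf z0; apply/cvgrPdist_le => e /= e0.
pose d := e / (2 * L).
have d0 : 0 < d by rewrite /d divr_gt0 ?mulr_gt0.
have cK := proj1 (compact_near_coveringP _) (@segment_compact R (- L) L).
have cF : continuous (fun p : V * R => f (p.1 + p.2 *: v)).
  apply: continuous_compf cf; apply: continuous_addf.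
    by move=> p; exact: cvg_fst.
  apply: continuous_scalef; first by move=> p; exact: cvg_snd.
  exact: continuous_cst.
(* tube lemma: a neighbourhood of z0 that works for all s of the segment *)
have near_unif : \forall z \near z0,
    `[- L, L]%classic `<=` (fun s => `|f (z0 + s *: v) - f (z + s *: v)| <= d).
  apply: (cK V (nbhs z0)
    (fun z s => `|f (z0 + s *: v) - f (z + s *: v)| <= d)) => s0 _.
  have d2 : 0 < d / 2 by rewrite divr_gt0.
  have /cvgrPdist_le/(_ _ d2) h1 := cF (z0, s0).
  have /cvgrPdist_le/(_ _ d2) h2 := @continuous_on_line f v z0 cf s0.
  case: h1 => -[P Q] /= [Pz Qs] PQ.
  exists (Q `&` (fun s => `|f (z0 + s0 *: v) - f (z0 + s *: v)| <= d / 2), P).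
    by split => //; exact: filterI.
  move=> [s z] /= [[Qs' h] Pz'].
  have /= h' := PQ (z, s) (conj Pz' Qs').
  have -> : f (z0 + s *: v) - f (z + s *: v) =
    (f (z0 + s0 *: v) - f (z + s *: v)) -
    (f (z0 + s0 *: v) - f (z0 + s *: v)) by ring.
  by rewrite (le_trans (ler_normB _ _))// [d]splitr lerD.
near=> z.
have nz := near near_unif z.
have nu s : - L <= s <= L -> `|f (z0 + s *: v) - f (z + s *: v)| <= d.
  by move=> h; apply: nz => //=; rewrite in_itv.
have dE : e = seg_int L (fun=> d).
  rewrite seg_int_cst ?ltW// /d divfK//; lra.
rewrite ler_distlC; apply/andP; split.
  rewrite lerBlDr dE -seg_intD; [|exact: continuous_on_line|exact: continuous_cst].
  apply: seg_int_le; first exact: continuous_on_line.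
    by apply: continuous_addf; [exact: continuous_on_line|exact: continuous_cst].
  by move=> s /nu; rewrite ler_distl => /andP[_]; rewrite addrC.
rewrite dE -seg_intD; [|exact: continuous_on_line|exact: continuous_cst].
apply: seg_int_le; first exact: continuous_on_line.
  by apply: continuous_addf; [exact: continuous_on_line|exact: continuous_cst].
by move=> s /nu; rewrite ler_distl => /andP[]; lra.
Unshelve. all: by end_near. Qed.

(** A directional derivative is the one-variable derivative along the line, which
    makes calculus on the real line available in any direction. *)
Lemma is_derive_along f x w (t d : R) :
  is_derive t (1 : R) (fun s => f (x + s *: w)) d <->
  is_derive (x + t *: w) w f d.
Proof.
have E : (fun h : R => h^-1 *: (((fun s => f (x + s *: w)) \o shift t) (h *: (1 : R)) - f (x + t *: w)))
  = (fun h : R => h^-1 *: ((f \o shift (x + t *: w)) (h *: w) - f (x + t *: w))).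
  apply/funext => h /=; congr (_ *: (f _ - _)).
  by rewrite [h *: 1]mulr1 scalerDl addrCA.
by split => -[h1 h2]; split; move: h1 h2; rewrite /derivable /derive ?E// -?E.
Qed.

(** Differentiation under the integral sign: f' is bounded on the compact
    parallelogram swept by the segment, and this bound is the dominating function.
    The set D, invariant in the direction of integration, is meant to be a slice
    1 < t < b, outside of which the time derivative is not controlled. *)
Lemma is_derive_line_int (D : set V) L v w f f' z : 0 < L ->
  continuous f -> continuous f' -> open D ->
  (forall y s, D y -> D (y + s *: v)) ->
  (forall y, D y -> is_derive y w f (f' y)) ->
  D z -> is_derive z w (line_int L v f) (line_int L v f' z).
Proof.
move=> L0 cf cf' oD Dv Df Dz.
have : \forall t \near (0 : R), D (z + t *: w).
  have cw : z + t *: w @[t --> (0 : R)] --> z + 0 *: w := @continuous_line w z 0.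
  rewrite scale0r addr0 in cw; exact: cw (open_nbhs_nbhs (conj oD Dz)).
move=> /nbhs_ballP[e /= e0 De].
pose a := e / 2; have a0 : 0 < a by rewrite divr_gt0.
have Da t : - a <= t <= a -> D (z + t *: w).
  move=> ta; apply: De; rewrite -ball_normE /ball_ /= sub0r normrN.
  by rewrite (@le_lt_trans _ _ a) ?ler_norml// /a; lra.
have [M M0 f'M] := @continuous_bounded_on_compact R (R * R)%type
    (fun p : R * R => f' (z + p.1 *: w + p.2 *: v)) (`[- a, a] `*` `[- L, L])
    (compact_setX (@segment_compact R (- a) a) (@segment_compact R (- L) L))
    ltac:(apply: continuous_compf cf'; apply: continuous_addf;
     [apply: continuous_addf; [exact: continuous_cst|]|];
     (apply: continuous_scalef; last exact: continuous_cst);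
     [move=> p; exact: cvg_fst|move=> p; exact: cvg_snd]).
pose h t s := f (z + t *: w + s *: v).
have dh t s : - a <= t <= a ->
    is_derive t (1 : R) (h ^~ s) (f' (z + t *: w + s *: v)).
  move=> ta; have -> : h ^~ s = fun t => f ((z + s *: v) + t *: w).
    by apply/funext => t' /=; rewrite /h addrAC.
  by rewrite addrAC; apply/is_derive_along; rewrite addrAC; apply: Df; exact/Dv/Da.
have h0 : (fun t => line_int L v f (z + t *: w)) = fun t => seg_int L (h t) by [].
suff : is_derive (0 : R) (1 : R) (fun t => seg_int L (h t)) (line_int L v f' z).
  by rewrite -h0 => /is_derive_along; rewrite scale0r addr0.
have /= := @cvg_differentiation_under_integral R _ _ (@lebesgue_measure R) h
  `[- L, L]%classic ltac:(by []) 0 (- a) a _ _ _ (fun=> M) _ _ _.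
have -> : \int[lebesgue_measure]_(y in `[(- L), L]) partial1of2 h 0 y = line_int L v f' z.
  apply: seg_int_eq => s sL; rewrite /partial1of2 derive1E.
  have [_ ->] := dh 0 s ltac:(lra); by rewrite scale0r addr0.
move=> H.
have {}H : h0^-1 *: (seg_int L (h (h0 *: (1 : R) + 0)) - seg_int L (h 0)) @[h0 --> 0^'] --> line_int L v f' z.
  under eq_fun do rewrite [_ *: 1]mulr1.
  apply: H.
  - by rewrite /= in_itv/=; lra.
  - move=> t _; apply: seg_integrable; exact: continuous_on_line.
  - move=> t s /=; rewrite in_itv/= => ta _; have [] := dh t s => //; lra.
  - by move=> _; exact: ltW.
  - by apply: seg_integrable; exact: continuous_cst.
  - move=> t s /=; rewrite !in_itv/= => ta sL.
    rewrite /partial1of2 derive1E; have [|_ ->] := dh t s; first lra.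
    by apply: (f'M (t, s)); split; rewrite /= in_itv/=; lra.
by split; [apply/cvg_ex; exists (line_int L v f' z)|apply: cvg_lim].
Qed.

Lemma line_int_le L v f g z : continuous f -> continuous g ->
  (forall s, - L <= s <= L -> f (z + s *: v) <= g (z + s *: v)) ->
  line_int L v f z <= line_int L v g z.
Proof. by move=> cf cg; apply: seg_int_le; exact: continuous_on_line. Qed.

Lemma line_int_derive L v f f' z : 0 < L -> continuous f' ->
  (forall s : R, is_derive (z + s *: v) v f (f' (z + s *: v))) ->
  line_int L v f' z = f (z + L *: v) - f (z - L *: v).
Proof.
move=> L0 cf' df; rewrite -scaleNr /line_int.
apply: (@seg_int_FTC _ _ (fun s => f (z + s *: v))) => //.
  by move=> s; exact/is_derive_along.
exact: continuous_on_line.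
Qed.

Lemma line_int_eq0 L v f z : 0 < L -> continuous f -> (forall y, 0 <= f y) ->
  line_int L v f z = 0 -> f z = 0.
Proof.
move=> L0 cf f0 /seg_int_eq0 -/(_ L0 (@continuous_on_line f v z cf) (fun=> f0 _)).
by rewrite scale0r addr0.
Qed.

End LineIntegral.

(** * Iterated integrals over boxes in space *)

Section BoxIntegral.
Context {R : realType} {n : nat}.
Local Notation Z := (R * 'rV[R]_n)%type.
Implicit Types (f g : Z -> R) (L : R) (z w y : Z) (l : seq 'I_n).

Definition dt : Z := (1, 0).
Definition dx (i : 'I_n) : Z := (0, basis_vec R i).

Lemma time_shift z (s : R) i : (z + s *: dx i).1 = z.1.
Proof. by rewrite /= [s *: 0]mulr0 addr0. Qed.

Lemma coord_shift z (s : R) i j :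
  (z + s *: dx i).2 0 j = z.2 0 j + s * (j == i)%:R.
Proof. by rewrite /= !mxE eqxx. Qed.

Fixpoint iter_int L l f : Z -> R :=
  if l is i :: l' then line_int L (dx i) (iter_int L l' f) else f.

Lemma continuous_iter_int L l f : 0 < L -> continuous f ->
  continuous (iter_int L l f).
Proof.
by move=> L0 cf; elim: l => [|i l ih] //=; exact: continuous_line_int.
Qed.

(** The functions are compared only on the box: same time, same coordinates in
    the directions that are not integrated. *)
Lemma iter_int_le L l f g z : 0 < L -> uniq l -> continuous f -> continuous g ->
  (forall w, w.1 = z.1 -> (forall j, j \in l -> `|w.2 0 j - z.2 0 j| <= L) ->
     (forall j, j \notin l -> w.2 0 j = z.2 0 j) -> f w <= g w) ->
  iter_int L l f z <= iter_int L l g z.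
Proof.
move=> L0 + cf cg; elim: l z => [|i l ih] z /=; first by move=> _; apply.
move=> /andP[il ul] fg; apply: line_int_le; try exact: continuous_iter_int.
move=> s sL; apply: ih => // w w1 wl wl'; apply: fg.
- by rewrite w1 time_shift.
- move=> j; rewrite inE => /predU1P[->|jl].
    rewrite wl'// coord_shift eqxx mulr1 addrAC subrr add0r.
    by rewrite ler_norml.
  move: (wl j jl); rewrite coord_shift; suff /negPf -> : j != i.
    by rewrite mulr0 addr0.
  by apply: contraNneq il => <-.
- move=> j; rewrite inE negb_or => /andP[ji jl]; rewrite wl'// coord_shift.
  by rewrite (negPf ji) mulr0 addr0.
Qed.

Lemma iter_int_eq L l f g z : 0 < L -> uniq l -> continuous f -> continuous g ->
  (forall w, w.1 = z.1 -> (forall j, j \in l -> `|w.2 0 j - z.2 0 j| <= L) ->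
     (forall j, j \notin l -> w.2 0 j = z.2 0 j) -> f w = g w) ->
  iter_int L l f z = iter_int L l g z.
Proof.
move=> L0 ul cf cg fg; apply/eqP; rewrite eq_le.
by apply/andP; split; apply: iter_int_le => // w w1 w2 w3; rewrite fg.
Qed.

Lemma iter_intD L l f g : 0 < L -> continuous f -> continuous g ->
  iter_int L l (fun z => f z + g z) =
  (fun z => iter_int L l f z + iter_int L l g z).
Proof.
move=> L0 cf cg; elim: l => [//|i l ih] /=; rewrite ih; apply/funext => z.
by apply: seg_intD; apply: continuous_on_line; exact: continuous_iter_int.
Qed.

Lemma iter_intZ L l (k : R) f : 0 < L -> continuous f ->
  iter_int L l (fun z => k * f z) = (fun z => k * iter_int L l f z).
Proof.
move=> L0 cf; elim: l => [//|i l ih] /=; rewrite ih; apply/funext => z.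
by apply: seg_intZ; apply: continuous_on_line; exact: continuous_iter_int.
Qed.

Lemma iter_int_cst L l (k : R) z : 0 < L ->
  iter_int L l (fun=> k) z = k * (2 * L) ^+ size l.
Proof.
move=> L0; elim: l z => [|i l ih] z /=; first by rewrite mulr1.
rewrite /line_int; under [X in seg_int _ X]eq_fun do rewrite ih.
by rewrite seg_int_cst ?ltW// exprS; ring.
Qed.

Lemma iter_int_shrink L L' l f z : 0 < L -> L <= L' -> uniq l -> continuous f ->
  (forall w, w.1 = z.1 -> (exists2 j, j \in l & L < `|w.2 0 j - z.2 0 j|) ->
     f w = 0) ->
  iter_int L' l f z = iter_int L l f z.
Proof.
move=> L0 LL' + cf; have L'0 := lt_le_trans L0 LL'.
elim: l z => [//|i l ih] z /= /andP[il ul] f0.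
rewrite /line_int (@seg_int_shrink _ L L')//; last first.
  move=> s Ls; rewrite (@iter_int_eq _ _ _ (fun=> 0))//.
  - by rewrite iter_int_cst// mul0r.
  - exact: continuous_cst.
  - move=> w w1 wl wl'; apply: f0; first by rewrite w1 time_shift.
    exists i; first by rewrite inE eqxx.
    by rewrite wl'// coord_shift eqxx mulr1 addrAC subrr add0r.
apply: seg_int_eq => s sL; apply: ih => // w w1 [j jl wj].
apply: f0; first by rewrite w1 time_shift.
exists j; first by rewrite inE jl orbT.
move: wj; rewrite coord_shift; suff /negPf -> : j != i.
  by rewrite mulr0 addr0.
by apply: contraNneq il => <-.
Qed.

Lemma is_derive_iter_int (D : set Z) L l v f f' z : 0 < L ->
  continuous f -> continuous f' -> open D ->
  (forall y s i, D y -> D (y + s *: dx i)) ->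
  (forall y, D y -> is_derive y v f (f' y)) ->
  D z -> is_derive z v (iter_int L l f) (iter_int L l f' z).
Proof.
move=> L0 cf cf' oD Dv Df; elim: l z => [|i l ih] z Dz /=; first exact: Df.
apply: (@is_derive_line_int _ _ D) => //; try exact: continuous_iter_int.
by move=> y s; exact: Dv.
Qed.

(** Integration by parts in its simplest form: a derivative in an integrated
    direction has zero integral if its primitive vanishes on the two faces
    orthogonal to that direction.  The integrals outside the i-th one integrate
    zero, and those inside it commute with the derivative. *)
Lemma iter_int_partial0 L l i g g' z : 0 < L -> i \in l -> uniq l ->
  continuous g -> continuous g' ->
  (forall y, is_derive y (dx i) g (g' y)) ->
  (forall w, w.1 = z.1 -> `|w.2 0 i - z.2 0 i| = L -> g w = 0) ->
  iter_int L l g' z = 0.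
Proof.
move=> L0 + + cg cg' dg; elim: l z => [//|j l ih] z.
rewrite inE => /predU1P[<-|il] /= /andP[jl ul] g0; last first.
  rewrite /line_int (@seg_int_eq _ _ _ (fun=> 0)).
    by rewrite seg_int_cst ?mul0r// ltW.
  move=> s sL; apply: ih => // w w1 wi; apply: g0.
    by rewrite w1 time_shift.
  move: wi; rewrite coord_shift; suff /negPf -> : i != j.
    by rewrite mulr0 addr0.
  by apply: contraNneq jl => <-.
have v0 s : `|s| = L -> iter_int L l g (z + s *: dx i) = 0.
  move=> sL; rewrite (@iter_int_eq _ _ _ (fun=> 0))//.
  - by rewrite iter_int_cst// mul0r.
  - exact: continuous_cst.
  - move=> w w1 wl wl'; apply: g0; first by rewrite w1 time_shift.
    by rewrite wl'// coord_shift eqxx mulr1 addrAC subrr add0r.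
transitivity (iter_int L l g (z + L *: dx i) - iter_int L l g (z - L *: dx i)).
  apply: line_int_derive => //; first exact: continuous_iter_int.
  by move=> s; apply: (@is_derive_iter_int setT) => //; exact: openT.
by rewrite -scaleNr !v0 ?subrr// ?normrN gtr0_norm.
Qed.

Lemma iter_int_eq0 L l f z : 0 < L -> continuous f -> (forall y, 0 <= f y) ->
  iter_int L l f z = 0 -> f z = 0.
Proof.
move=> L0 cf f0.
have i0 k y : 0 <= iter_int L k f y.
  elim: k y => [//|i k ih] y /=; rewrite -[0](_ : line_int L (dx i) (fun=> 0) y = 0).
    apply: line_int_le => //; first exact: continuous_cst.
    exact: continuous_iter_int.
  by rewrite /line_int seg_int_cst ?mul0r// ltW.
elim: l => [//|i l ih] /= h; apply: ih.
by apply: line_int_eq0 h => //; exact: continuous_iter_int.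
Qed.

End BoxIntegral.
Arguments dt {R n}.

(** * Blow-up of solutions of a differential inequality *)

Section Blowup.
Context {R : realType}.

Lemma ge0_derive_le (g dg : R -> R) (a b : R) : a <= b -> continuous g ->
  (forall x, a < x < b -> is_derive x (1 : R) g (dg x)) ->
  (forall x, a < x < b -> 0 <= dg x) -> g a <= g b.
Proof.
move=> ab cg dg' dg0; move: ab; rewrite le_eqVlt => /predU1P[->//|ab].
have [x xab gE] := @MVT R g dg a b ab
  (fun x xab => dg' x ltac:(by move: xab; rewrite in_itv)) (continuous_subspaceT cg).
rewrite -subr_ge0 gE mulr_ge0//; last by rewrite subr_ge0 ltW.
by apply: dg0; rewrite in_itv in xab.
Qed.

Section Doubling.
Variables (p kappa k a b : R) (G G1 G2 : R -> R).
Hypotheses (p1 : 1 < p) (kappa0 : 0 <= kappa) (k0 : 0 < k).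
Hypotheses (cG : continuous G) (cG1 : continuous G1).
Hypothesis dG : forall s, a < s < b -> is_derive s (1 : R) G (G1 s).
Hypothesis dG1 : forall s, a < s < b -> is_derive s (1 : R) G1 (G2 s).
Hypothesis G1_ge0 : forall s, a <= s <= b -> 0 <= G1 s.
Hypothesis G2_ge : forall s, a < s < b -> k * G s `^ p <= G2 s + kappa * G1 s.

Lemma solution_nondecreasing s s' : a <= s -> s <= s' -> s' <= b -> G s <= G s'.
Proof.
move=> as_ ss' sb; apply: (@ge0_derive_le G G1) => // x xs.
  by apply: dG; lra.
by apply: G1_ge0; lra.
Qed.

(** Suppose that G stays below 2 f during the time tau = 2 r + 4 kappa r^2.  As G is
    at least f, the inequality gives (G' + kappa G)' >= q f, with q = k f^(p - 1), and
    kappa (G - G(s0)) is at most kappa f; hence G' >= q f (s - s0) - kappa f, and after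
    a second integration G(s0 + tau) >= f + q f tau^2 / 2 - kappa f tau.  With
    q r^2 = 1 the value of tau makes this at least 2 f. *)
Lemma solution_doubles f r s0 : 0 < f -> 0 < r -> k * f `^ (p - 1) * r ^+ 2 = 1 ->
  a <= s0 -> s0 + (2 * r + 4 * kappa * r ^+ 2) <= b -> f <= G s0 ->
  2 * f <= G (s0 + (2 * r + 4 * kappa * r ^+ 2)).
Proof.
have p0 : 0 < p := lt_trans ltr01 p1; have kappa_ge0 := kappa0.
move=> f0 r0 X as0; set tau := (2 * r + _) => s0b fG.
have kr0 : 0 <= kappa * r by rewrite mulr_ge0// ltW.
have tau0 : 0 < tau by rewrite /tau; nra.
rewrite leNgt; apply/negP => Glt.
have fp : k * f `^ p = (k * f `^ (p - 1)) * f.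
  by rewrite -(mulr_powRB1 (ltW f0) p0); ring.
set q := k * f `^ (p - 1) in X fp.
have q0 : 0 < q by rewrite mulr_gt0// powR_gt0.
have mono s : s0 <= s <= s0 + tau -> f <= G s < 2 * f.
  move=> /andP[h1 h2]; apply/andP; split.
    by rewrite (le_trans fG)// solution_nondecreasing//; lra.
  by rewrite (le_lt_trans _ Glt)// solution_nondecreasing//; lra.
have G1_lb s : s0 <= s <= s0 + tau -> q * f * (s - s0) - kappa * f <= G1 s.
  move=> /andP[h1 h2].
  have : G1 s0 + kappa * G s0 - q * f * s0 <= G1 s + kappa * G s - q * f * s.
    apply: (@ge0_derive_le (fun s => G1 s + kappa * G s - q * f * s)
      (fun s => G2 s + kappa * G1 s - q * f)) => //.
    - apply: continuous_subf; last first.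
        by apply: continuous_mulf; [exact: continuous_cst|move=> ?; exact: cvg_id].
      apply: continuous_addf => //.
      by apply: continuous_mulf => //; exact: continuous_cst.
    - move=> x xs.
      have d1 := dG (ltac:(lra) : a < x < b); have d2 := dG1 (ltac:(lra) : a < x < b).
      apply: is_derive_eq (is_derive_subf (is_derive_addf d2
        (is_derive_cstM kappa d1)) (is_derive_cstM (q * f) (is_derive_id _ _))) _.
      by rewrite mulr1.
    - move=> x xs; rewrite subr_ge0 (le_trans _ (G2_ge _)) -?fp//; last lra.
      rewrite ler_pM2l// ge0_ler_powR// ?nnegrE; try lra.
      + by have := mono x ltac:(lra); lra.
      + by have := mono x ltac:(lra); lra.
  have := G1_ge0 (ltac:(lra) : a <= s0 <= b).
  have hm := mono s ltac:(lra).
  have : 0 <= kappa * (G s0 - G s + f) by rewrite mulr_ge0//; lra.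
  lra.
have : G s0 - q * f / 2 * (s0 - s0) ^+ 2 + kappa * f * (s0 - s0) <=
   G (s0 + tau) - q * f / 2 * (s0 + tau - s0) ^+ 2 + kappa * f * (s0 + tau - s0).
  apply: (@ge0_derive_le (fun s => G s - q * f / 2 * (s - s0) ^+ 2 + kappa * f * (s - s0))
    (fun s => G1 s - q * f * (s - s0) + kappa * f)); first lra.
  - have cs : continuous (fun s => s - s0).
      by apply: continuous_subf; [move=> ?; exact: cvg_id|exact: continuous_cst].
    apply: continuous_addf; [apply: continuous_subf => //|].
      by apply: continuous_mulf; [exact: continuous_cst|exact: continuous_expf].
    by apply: continuous_mulf => //; exact: continuous_cst.
  - move=> x xs; have d1 := dG (ltac:(lra) : a < x < b).
    have dl : is_derive x (1 : R) (fun s => s - s0) (1 - 0).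
      exact: is_derive_subf.
    apply: is_derive_eq (is_derive_addf (is_derive_subf d1
      (is_derive_cstM (q * f / 2) (is_derive_sqrf dl)))
      (is_derive_cstM (kappa * f) dl)) _.
    by field.
  - by move=> x xs; have := G1_lb x ltac:(lra); lra.
have -> : s0 + tau - s0 = tau by ring.
rewrite subrr expr0n/= !mulr0 subr0 addr0 => Gub.
have : q / 2 * tau ^+ 2 = 2 + 8 * kappa * r + 8 * kappa ^+ 2 * r ^+ 2.
  transitivity ((q * r ^+ 2) * (2 + 8 * kappa * r + 8 * kappa ^+ 2 * r ^+ 2)).
    by rewrite /tau; field.
  by rewrite X mul1r.
move=> E; rewrite (_ : q * f / 2 * tau ^+ 2 = f * (q / 2 * tau ^+ 2)) in Gub; last by ring.
rewrite E in Gub.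
have : 0 <= f * (6 * kappa * r + 4 * kappa ^+ 2 * r ^+ 2) by rewrite mulr_ge0 ?addr_ge0 ?mulr_ge0 ?exprn_ge0// ltW.
have -> : f * (6 * kappa * r + 4 * kappa ^+ 2 * r ^+ 2) =
  f * (2 + 8 * kappa * r + 8 * kappa ^+ 2 * r ^+ 2) - 2 * f - kappa * f * tau.
  by rewrite /tau; ring.
lra.
Qed.

(** When f doubles, k f^(p - 1) is multiplied by 2^(p - 1), so r is multiplied by
    theta = 2^(-(p - 1) / 2) < 1.  The doubling times 2 r and 4 kappa r^2 thus form
    geometric series with ratios theta and theta^2; their sums bound the time after
    which any number m of doublings has taken place. *)
Lemma solution_dyadic_growth (theta : R) m f r s0 :
  0 < theta < 1 -> 2 `^ (p - 1) * theta ^+ 2 = 1 ->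
  0 < f -> 0 < r -> k * f `^ (p - 1) * r ^+ 2 = 1 -> a <= s0 -> f <= G s0 ->
  s0 + (2 * r / (1 - theta) + 4 * kappa * r ^+ 2 / (1 - theta ^+ 2)) <= b ->
  exists2 s, a <= s <= b & 2 ^+ m * f <= G s.
Proof.
have kappa_ge0 := kappa0.
move=> th01 thE; have th2 : 0 < 1 - theta ^+ 2 by nra.
elim: m f r s0 => [|m ih] f r s0 f0 r0 X as0 fG s0b.
  exists s0; last by rewrite expr0 mul1r.
  have : 0 <= 2 * r / (1 - theta) by rewrite divr_ge0//; lra.
  have : 0 <= 4 * kappa * r ^+ 2 / (1 - theta ^+ 2).
    by rewrite divr_ge0 ?(ltW th2)// mulr_ge0 ?exprn_ge0 ?mulr_ge0//; lra.
  lra.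
set tau := 2 * r + 4 * kappa * r ^+ 2.
have tailE : 2 * r / (1 - theta) + 4 * kappa * r ^+ 2 / (1 - theta ^+ 2) =
    tau + (2 * (r * theta) / (1 - theta) +
           4 * kappa * (r * theta) ^+ 2 / (1 - theta ^+ 2)).
  by rewrite /tau; field; rewrite !gt_eqF//; lra.
have tau0 : 0 < tau.
  by rewrite ltr_wpDr ?mulr_gt0// !mulr_ge0 ?exprn_ge0// ltW.
have tail0 : 0 <= 2 * (r * theta) / (1 - theta) +
    4 * kappa * (r * theta) ^+ 2 / (1 - theta ^+ 2).
  rewrite addr_ge0// divr_ge0 ?(ltW th2)//; try lra.
  - by rewrite !mulr_ge0//; lra.
  - by rewrite !mulr_ge0 ?exprn_ge0 ?mulr_ge0//; lra.
have [||||||s sab sG] := ih (2 * f) (r * theta) (s0 + tau).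
- by rewrite mulr_gt0.
- by rewrite mulr_gt0//; lra.
- rewrite powRM ?ltW//.
  transitivity ((k * f `^ (p - 1) * r ^+ 2) * (2 `^ (p - 1) * theta ^+ 2)).
    ring.
  by rewrite X thE mulr1.
- by lra.
- by apply: solution_doubles => //; rewrite -/tau; lra.
- by lra.
by exists s => //; rewrite exprSr -mulrA.
Qed.

Lemma blowup_time_bound (theta : R) f r :
  0 < theta < 1 -> 2 `^ (p - 1) * theta ^+ 2 = 1 -> a <= b ->
  0 < f -> 0 < r -> k * f `^ (p - 1) * r ^+ 2 = 1 -> f <= G a ->
  b < a + (2 * r / (1 - theta) + 4 * kappa * r ^+ 2 / (1 - theta ^+ 2)).
Proof.
move=> th01 thE ab f0 r0 X fG; rewrite ltNge; apply/negP => h.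
have grow m : 2 ^+ m * f <= G b.
  have [s /andP[sa sb] sG] :=
    solution_dyadic_growth m th01 thE f0 r0 X (lexx a) fG h.
  by rewrite (le_trans sG)// solution_nondecreasing.
have := grow (Num.Def.truncn (G b / f)).+1.
rewrite -ler_pdivlMr//; apply/negP; rewrite -ltNge.
apply: lt_trans (truncnS_gt _) _; rewrite -natrX ltr_nat; exact: ltn_expl.
Qed.

End Doubling.
End Blowup.

Lemma powR_expR (R : realType) (s a : R) : expR s `^ a = expR (a * s).
Proof. by rewrite /powR gt_eqF ?expR_gt0// expRK. Qed.

(** With t = e^s one has t^2 (F'' + (mu / t) F') = G'' + (mu - 1) G' for
    G(s) = F(e^s).  Since G' >= 0, mu - 1 may be replaced by any larger kappa, and for
    s >= s0 the factor e^((2 - q) s) by its value at s0. *)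
Lemma ode_blowup_bound (R : realType) (p mu kappa c q b s0 theta f r : R)
    (F F1 F2 : R -> R) :
  1 < p -> 0 <= kappa -> mu - 1 <= kappa -> 0 < c -> q <= 2 ->
  continuous F -> continuous F1 ->
  (forall t, 1 < t < b -> is_derive t (1 : R) F (F1 t)) ->
  (forall t, 1 < t < b -> is_derive t (1 : R) F1 (F2 t)) ->
  (forall t, 1 <= t <= b -> 0 <= F1 t) ->
  (forall t, 1 < t < b -> c * t `^ (- q) * F t `^ p <= F2 t + mu / t * F1 t) ->
  0 <= s0 -> expR s0 <= b ->
  0 < theta < 1 -> 2 `^ (p - 1) * theta ^+ 2 = 1 ->
  0 < f -> f <= F 1 -> 0 < r ->
  c * expR ((2 - q) * s0) * f `^ (p - 1) * r ^+ 2 = 1 ->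
  b < expR (s0 + (2 * r / (1 - theta) + 4 * kappa * r ^+ 2 / (1 - theta ^+ 2))).
Proof.
move=> p1 k0 muk c0 q2 cF cF1 dF dF1 F1ge0 ode s00 s0b th01 thE f0 fF r0 X.
have cexp : continuous (@expR R) by exact: continuous_expR.
have b0 : 0 < b := lt_le_trans (expR_gt0 _) s0b.
rewrite -ltr_ln ?posrE ?expR_gt0// expRK.
have s0lnb : s0 <= ln b by rewrite -(expRK s0) ler_ln ?posrE ?expR_gt0.
have expb s : s <= ln b -> expR s <= b.
  by move=> h; rewrite -[leRHS]lnK ?posrE// ler_expR.
have exp1 s : 0 <= s -> 1 <= expR s by move=> h; rewrite -expR0 ler_expR.
have expin s : s0 < s < ln b -> 1 < expR s < b.
  move=> /andP[h1 h2]; rewrite -{1}expR0 ltr_expR (le_lt_trans s00 h1)/=.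
  by rewrite -[ltRHS]lnK ?posrE// ltr_expR.
apply: (@blowup_time_bound R p kappa (c * expR ((2 - q) * s0)) s0 (ln b)
  (fun s => F (expR s)) (fun s => F1 (expR s) * expR s)
  (fun s => F2 (expR s) * expR s * expR s + F1 (expR s) * expR s)
  p1 k0 _ _ _ _ _ _ _ theta f r) => //.
- by rewrite mulr_gt0 ?expR_gt0.
- exact: continuous_compf.
- by apply: continuous_mulf => //; exact: continuous_compf.
- move=> s sin; have /expin h := sin.
  exact: is_derive_eq (is_derive1_comp (dF _ h) (is_derive_expR s)) _.
- move=> s sin; have /expin h := sin.
  apply: is_derive_eq (is_derive_mulf (is_derive1_comp (dF1 _ h) (is_derive_expR s))
    (is_derive_expR s)) _.
  by rewrite /=; ring.
- move=> s /andP[h1 h2]; rewrite mulr_ge0 ?expR_ge0// F1ge0//.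
  by rewrite exp1 ?expb// (le_trans s00).
- move=> s sin; have /expin h := sin; set t := expR s in h *.
  have t0 : 0 < t by exact: expR_gt0.
  apply: (@le_trans _ _ (t ^+ 2 * (F2 t + mu / t * F1 t))); last first.
    rewrite -subr_ge0; have -> : F2 t * t * t + F1 t * t + kappa * (F1 t * t) -
        t ^+ 2 * (F2 t + mu / t * F1 t) = (kappa - (mu - 1)) * (F1 t * t).
      by field; rewrite gt_eqF.
    rewrite mulr_ge0 ?subr_ge0// mulr_ge0 ?(ltW t0)// F1ge0//; lra.
  apply: le_trans (ler_wpM2l _ (ode _ h)); last exact: exprn_ge0 (ltW t0).
  have -> : t ^+ 2 * (c * t `^ (- q) * F t `^ p) =
      c * expR ((2 - q) * s) * F t `^ p.
    rewrite /t powR_expR mulrBl expRB mulNr expRN expRM_natl; ring.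
  rewrite ler_wpM2r ?powR_ge0// ler_pM2l// ler_expR ler_wpM2l//; lra.
- apply: le_trans fF _; apply: (@ge0_derive_le _ F F1) => //; first exact: exp1.
    by move=> x /andP[h1 h2]; apply: dF; rewrite h1 (lt_le_trans h2).
  move=> x /andP[h1 h2]; apply: F1ge0.
  by rewrite (ltW h1) ltW// (lt_le_trans h2).
Qed.

(** * Functions on the slab as functions on space-time *)

Section SlabExtension.
Context {R : realType} {n : nat}.
Local Notation Z := (R * 'rV[R]_n)%type.
Variables (b : R) (T : \bar R).
Hypotheses (b1 : 1 <= b) (bT : (b%:E < T)%E).
Implicit Types (v : R -> 'rV[R]_n -> R) (z : Z).

(** Freezing the time outside [1, b] turns a function that is continuous on the slab
    into one that is continuous on the whole space-time, as the integrals require.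
    Space derivatives are compatible with this everywhere, the time derivative for
    1 < t < b. *)
Definition clamp (t : R) : R := Num.max 1 (Num.min t b).

Definition ext v z : R := v (clamp z.1) z.2.

Lemma clamp_ge1 t : 1 <= clamp t.
Proof. by rewrite le_max lexx. Qed.

Lemma clamp_le t : clamp t <= b.
Proof. by rewrite ge_max b1 ge_min lexx orbT. Qed.

Lemma clamp_id t : 1 <= t <= b -> clamp t = t.
Proof. by move=> /andP[t1 tb]; rewrite /clamp min_l// max_r. Qed.

Lemma continuous_clamp : continuous clamp.
Proof.
move=> t; apply: (@continuous_max R R (cst 1) (fun t => Num.min t b)).
  exact: cvg_cst.
by apply: (@continuous_min R R id (cst b)); [exact: cvg_id|exact: cvg_cst].
Qed.

Lemma slab_clamp t x : slab n T (clamp t, x).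
Proof.
split; first exact: clamp_ge1.
by apply: le_lt_trans bT; rewrite lee_fin clamp_le.
Qed.

Lemma continuous_clamp_fst : continuous (fun z : Z => clamp z.1).
Proof.
by apply: continuous_compf continuous_clamp => z; exact: cvg_fst.
Qed.

Lemma continuous_ext v : slab_Ck 0 T v -> continuous (ext v).
Proof.
move=> /subspace_continuousP cv z.
have cc : (fun z : Z => (clamp z.1, z.2)) @ z --> (clamp z.1, z.2).
  have c1 := @continuous_clamp_fst z.
  have c2 : (fun y : Z => y.2) @ z --> z.2 by exact: cvg_snd.
  exact: (cvg_pair c1 c2).
have cw : (fun z : Z => (clamp z.1, z.2)) @ z -->
    within (slab n T) (nbhs (clamp z.1, z.2)).
  move=> P /= hP; have := cc _ hP; rewrite /= !nbhs_simpl/=.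
  by apply: filterS => y /=; apply; exact: slab_clamp.
exact: cvg_comp cw (cv _ (slab_clamp _ _)).
Qed.

Lemma slab_Ck0 k v : slab_Ck k T v -> slab_Ck 0 T v.
Proof. by case: k => //= k []. Qed.

Lemma time_filter_interior t : 1 < t -> time_filter t = (0 : R)^'.
Proof.
move=> t1; apply/seteqP; split => P; rewrite /time_filter /within/= => hP.
  have : \forall h \near (0 : R)^', 1 <= t + h.
    apply: cvg_within; near=> h.
    have : `|h| < t - 1 by near: h; exists (t - 1); rewrite /= ?subr_gt0// => y /=; rewrite sub0r normrN.
    by rewrite ltr_norml => /andP[]; lra.
  by move=> h1; near=> h; apply: (near hP h) => //; near: h.
by apply: filterS hP => h ? _.
Unshelve. all: by end_near. Qed.

Lemma is_derive_time k v (t : R) x : slab_Ck k.+1 T v -> 1 < t -> (t%:E < T)%E ->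
  is_derive ((t, x) : Z) dt (fun z => v z.1 z.2) (time_derive v t x).
Proof.
move=> [_ dv _ _ _] t1 tT.
have E : (fun h : R => h^-1 *: (((fun z : Z => v z.1 z.2) \o shift (t, x)) (h *: dt)
    - v t x)) = time_quot v t x.
  apply/funext => h; rewrite /time_quot; congr (_ * (v _ _ - _)).
    by rewrite /= [h *: 1]mulr1 addrC.
  by rewrite /= scaler0 add0r.
have := dv t x (conj (ltW t1) tT).
rewrite /time_derivable /time_derive time_filter_interior// -E => h.
by split.
Qed.

Lemma ext_near v z : 1 < z.1 < b -> \near z, v z.1 z.2 = ext v z.
Proof.
move=> /andP[z1 zb]; have cf : y.1 @[y --> z] --> z.1 by exact: cvg_fst.
near=> y; rewrite /ext clamp_id//.
apply/andP; split; apply/ltW; near: y; [exact: cf (lt_nbhsr _)|].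
exact: cf (lt_nbhsl _).
Unshelve. all: by end_near. Qed.

Lemma is_derive_ext_time k v z : slab_Ck k.+1 T v -> 1 < z.1 < b ->
  is_derive z dt (ext v) (ext (time_derive v) z).
Proof.
move=> vC zb; apply: near_eq_is_derive (ext_near v zb) _.
case: z zb => t x /= /andP[t1 tb]; rewrite /ext/= clamp_id ?(ltW t1) ?ltW//.
by apply: is_derive_time vC _ _ => //; apply: lt_trans bT; rewrite lte_fin.
Qed.

Lemma is_derive_ext_space k v z i : slab_Ck k.+1 T v ->
  is_derive z (dx i) (ext v) (ext (space_partial i v) z).
Proof.
move=> [_ _ dv _ _]; case: z => t x.
have E : (fun h : R => h^-1 *: ((ext v \o shift (t, x)) (h *: dx i) - ext v (t, x)))
  = (fun h : R => h^-1 *: ((v (clamp t) \o shift x) (h *: basis_vec R i) - v (clamp t) x)).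
  apply/funext => h; congr (_ *: (_ - _)).
  by rewrite /ext/= [h *: 0]mulr0 add0r.
have := dv (clamp t) x i (slab_clamp _ _).
rewrite /derivable -E => h; split => //.
by rewrite /derive E.
Qed.

End SlabExtension.

(** * Equality of mixed derivatives *)

Lemma seg_int_small_gt0 (R : realType) (g : R -> R) : continuous g -> 0 < g 0 ->
  exists2 L, 0 < L & 0 < seg_int L g.
Proof.
move=> cg g0; have /cvgrPdist_lt/(_ (g 0 / 2)) := cg 0.
move=> /(_ ltac:(lra))/nbhs_ballP[d /= d0 db].
exists (d / 2); first by rewrite divr_gt0.
apply: (@lt_le_trans _ _ (seg_int (d / 2) (fun=> g 0 / 2))).
  by rewrite seg_int_cst ?mulr_gt0//; lra.
apply: seg_int_le => //; first exact: continuous_cst.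
move=> s sd; have : ball 0 d s.
  by rewrite -ball_normE /ball_ /= sub0r normrN ltr_norml; lra.
by move=> /db /=; rewrite ltr_norml => /andP[]; lra.
Qed.

Lemma seg_int_all0 (R : realType) (g : R -> R) : continuous g ->
  (forall L, 0 < L -> seg_int L g = 0) -> g 0 = 0.
Proof.
move=> cg gI; case: (ltgtP (g 0) 0) => // g0.
- have cNg : continuous (fun s => -1 * g s).
    by apply: continuous_mulf => //; exact: continuous_cst.
  have [L L0] := @seg_int_small_gt0 _ (fun s => -1 * g s) cNg ltac:(rewrite /=; lra).
  by rewrite seg_intZ// gI// mulr0 ltxx.
- by have [L L0] := seg_int_small_gt0 cg g0; rewrite gI// ltxx.
Qed.

Lemma is_derive_translate (R : realType) (V : normedModType R) (f : V -> R)
    (x v c : V) (d : R) :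
  is_derive (x + c) v f d -> is_derive x v (fun y => f (y + c)) d.
Proof.
have E : (fun h : R => h^-1 *: (((fun y => f (y + c)) \o shift x) (h *: v) - f (x + c)))
  = (fun h : R => h^-1 *: ((f \o shift (x + c)) (h *: v) - f (x + c))).
  by apply/funext => h /=; rewrite addrA.
by move=> -[h1 h2]; split; move: h1 h2; rewrite /derivable /derive ?E// -?E.
Qed.

(** Schwarz's theorem, through integrals.  The integral of d_v f over a segment in
    the direction v is a difference of values of f; its derivative along w is on the
    one hand the integral of d_w d_v f, on the other hand the same difference for
    d_w f, that is the integral of d_v d_w f.  As this holds for all lengths of the
    segment, the two continuous integrands agree at its centre. *)
Lemma mixed_derivatives_commute (R : realType) (V : normedModType R) (D : set V)
    (v w : V) (f fv fw fvw fwv : V -> R) (z : V) :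
  open D -> (forall y s, D y -> D (y + s *: v)) ->
  continuous fv -> continuous fvw -> continuous fwv ->
  (forall y, is_derive y v f (fv y)) ->
  (forall y, D y -> is_derive y w f (fw y)) ->
  (forall y, D y -> is_derive y w fv (fvw y)) ->
  (forall y, D y -> is_derive y v fw (fwv y)) ->
  D z -> fvw z = fwv z.
Proof.
move=> oD Dv cfv cfvw cfwv dfv dfw dfvw dfwv Dz.
have IE L : 0 < L -> line_int L v fvw z = line_int L v fwv z.
  move=> L0.
  have d1 : is_derive z w (line_int L v fv) (line_int L v fvw z).
    by apply: (@is_derive_line_int _ _ D).
  have d2 : is_derive z w (line_int L v fv) (fw (z + L *: v) - fw (z - L *: v)).
    have -> : line_int L v fv = fun y => f (y + L *: v) - f (y - L *: v).
      by apply/funext => y; apply: line_int_derive.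
    apply: is_derive_subf; apply: is_derive_translate; apply: dfw.
      exact: Dv.
    by rewrite -scaleNr; exact: Dv.
  have -> : line_int L v fwv z = fw (z + L *: v) - fw (z - L *: v).
    by apply: line_int_derive => // s; apply: dfwv; exact: Dv.
  by case: d1 => _ <-; case: d2 => _ <-.
apply/eqP; rewrite -subr_eq0; apply/eqP.
have cd : continuous (fun y => fvw y - fwv y) by exact: continuous_subf.
have := @seg_int_all0 _ (fun s => fvw (z + s *: v) - fwv (z + s *: v)).
rewrite scale0r addr0; apply.
  exact: (@continuous_on_line _ _ (fun y => fvw y - fwv y)).
move=> L L0.
have -> : (fun s => fvw (z + s *: v) - fwv (z + s *: v)) =
    (fun s => fvw (z + s *: v) + (-1) * fwv (z + s *: v)).
  by apply/funext => s; rewrite mulN1r.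
have c1 : continuous (fun s : R => fwv (z + s *: v)) by exact: continuous_on_line.
have c2 : continuous (fun s : R => fvw (z + s *: v)) by exact: continuous_on_line.
rewrite seg_intD//; last by apply: continuous_mulf => //; exact: continuous_cst.
rewrite seg_intZ// -/(line_int L v fvw z) -/(line_int L v fwv z) IE//.
by rewrite mulN1r subrr.
Qed.

(** Squaring the positive part makes it C^1: where g vanishes, the difference quotient
    is dominated by that of g^2, whose derivative is 0 there. *)
Lemma is_derive_sqr_pos_part (R : realType) (V : normedModType R) (g : V -> R)
    (x v : V) (d : R) : continuous g -> is_derive x v g d ->
  is_derive x v (fun y => Num.max 0 (g y) ^+ 2) (2 * Num.max 0 (g x) * d).
Proof.
move=> cg dg; case: (ltgtP (g x) 0) => gx.
- rewrite !mulr0 mul0r; apply: (near_eq_is_derive (f := cst 0)).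
  near=> y; rewrite max_l ?expr0n//; apply/ltW; near: y.
  exact: cg (lt_nbhsl gx).
- apply: (near_eq_is_derive (f := fun y => g y ^+ 2)).
    near=> y; rewrite max_r//; apply/ltW; near: y.
    exact: cg (lt_nbhsr gx).
  exact: is_derive_sqrf.
- have := is_derive_sqrf dg; rewrite gx !mulr0 mul0r => -[dq vq].
  suff : h^-1 *: (((fun y => Num.max 0 (g y) ^+ 2) \o shift x) (h *: v) -
      Num.max 0 (g x) ^+ 2) @[h --> 0^'] --> (0 : R).
    by move=> h; split; [apply/cvg_ex; exists 0|apply: cvg_lim].
  have q0 : h^-1 *: (((fun y => g y ^+ 2) \o shift x) (h *: v) - g x ^+ 2)
      @[h --> 0^'] --> 'D_v (fun y => g y ^+ 2) x := dq.
  move: q0; rewrite vq => /cvgr0Pnorm_le q0; apply/cvgr0Pnorm_le => e e0.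
  apply: filterS (q0 e e0) => h /= he; apply: le_trans he.
  rewrite /GRing.scale/= !normrM ler_wpM2l// gx maxxx expr0n subr0 subr0.
  rewrite !normrX lerXn2r ?nnegrE//.
  by rewrite /Num.max; case: ifP => _; rewrite ?normr0.
Unshelve. all: by end_near. Qed.

(** * Coordinates in space-time *)

Section SpaceTimeDerivatives.
Context {R : realType} {n : nat}.
Local Notation Z := (R * 'rV[R]_n)%type.

Lemma is_derive_coord_space (z : Z) (i j : 'I_n) :
  is_derive z (dx i) (fun y : Z => y.2 0 j) (j == i)%:R.
Proof.
rewrite -[z]addr0 -[X in z + X](scale0r (dx i)); apply/is_derive_along.
under eq_fun do rewrite coord_shift.
apply: is_derive_eq (is_derive_addf (is_derive_cst _ _ _)
  (is_derive_mulf (is_derive_id _ _) (is_derive_cst _ _ _))) _.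
by rewrite mulr0 mul1r !add0r.
Qed.

Lemma is_derive_coord_time (z : Z) (j : 'I_n) :
  is_derive z dt (fun y : Z => y.2 0 j) 0.
Proof.
rewrite -[z]addr0 -[X in z + X](scale0r dt); apply/is_derive_along.
rewrite (_ : (fun s => _) = cst (z.2 0 j)); first exact: is_derive_cst.
by apply/funext => s; rewrite /= scaler0 addr0.
Qed.

Lemma is_derive_time_space (h : R -> R) (z : Z) (i : 'I_n) :
  is_derive z (dx i) (fun y : Z => h y.1) 0.
Proof.
rewrite -[z]addr0 -[X in z + X](scale0r (dx i)); apply/is_derive_along.
under eq_fun do rewrite time_shift.
exact: is_derive_cst.
Qed.

Lemma is_derive_clamp_time (h : R -> R) (b d : R) (z : Z) : 1 < z.1 < b ->
  is_derive z.1 (1 : R) h d ->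
  is_derive z dt (fun y : Z => h (clamp b y.1)) d.
Proof.
move=> zb dh; apply: near_eq_is_derive (@ext_near _ _ b (fun t _ => h t) z zb) _.
rewrite -[z]addr0 -[X in z + X](scale0r dt); apply/is_derive_along.
rewrite (_ : (fun s => _) = (fun s => h (s + z.1))).
  by apply: is_derive_translate; rewrite add0r.
by apply/funext => s /=; rewrite [s *: 1]mulr1 addrC.
Qed.

Lemma time_line (t : R) (x : 'rV[R]_n) : (t, x) = (0, x) + t *: dt :> Z.
Proof. by congr pair; rewrite /= ?scaler0 ?addr0// [t *: 1]mulr1 add0r. Qed.

Lemma continuous_time_line (f : Z -> R) (x : 'rV[R]_n) :
  continuous f -> continuous (fun t : R => f (t, x)).
Proof.
by move=> cf; under eq_fun do rewrite time_line; exact: continuous_on_line.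
Qed.

Lemma is_derive_time_line (f : Z -> R) (t d : R) (x : 'rV[R]_n) :
  is_derive ((t, x) : Z) dt f d -> is_derive t (1 : R) (fun t : R => f (t, x)) d.
Proof.
rewrite time_line => df; under eq_fun do rewrite time_line.
exact/is_derive_along.
Qed.

Lemma continuous_coord (j : 'I_n) : continuous (fun y : Z => y.2 0 j).
Proof.
apply: (@continuous_compf _ _ _ (fun y : Z => y.2) (fun x => x 0 j)).
  by move=> z; exact: cvg_snd.
exact: coord_continuous.
Qed.

Lemma continuous_powR_clamp (b e : R) :
  continuous (fun y : Z => clamp b y.1 `^ e).
Proof.
move=> z; have c0 : 0 < clamp b z.1 by rewrite (lt_le_trans ltr01)// clamp_ge1.
have cp : {for clamp b z.1, continuous (fun s : R => s `^ e)}.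
  apply/differentiable_continuous/derivable1_diffP.
  by case: (is_derive1_powR e c0).
have cc := @continuous_clamp_fst R n b z.
exact: (@continuous_comp _ _ _ (fun y : Z => clamp b y.1) (fun s => s `^ e) z cc cp).
Qed.

Lemma partial_eq0 (h : 'rV[R]_n -> R) (rho : R) (i j : 'I_n) (x : 'rV[R]_n) :
  (forall y : 'rV[R]_n, rho < `|y 0 i| -> h y = 0) -> rho < `|x 0 i| -> partial j h x = 0.
Proof.
move=> h0 xi; rewrite /partial (@near_eq_derive _ _ _ _ (cst 0)) ?derive_cst//.
have cn : {for x, continuous (fun y : 'rV[R]_n => `|y 0 i|)}.
  by apply: (@continuous_compf _ _ _ (fun y : 'rV[R]_n => y 0 i) Num.norm);
    [exact: coord_continuous|exact: norm_continuous].
near=> y; apply: h0; near: y; exact: cn (lt_nbhsr xi).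
Unshelve. all: by end_near. Qed.

Lemma coord_le_enorm (x : 'rV[R]_n) i : `|x 0 i| <= enorm x.
Proof.
rewrite /enorm -sqrtr_sqr ler_wsqrtr// (bigD1 i)//= lerDl.
by apply: sumr_ge0 => j _; exact: sqr_ge0.
Qed.

Lemma supported_eq0 (h : 'rV[R]_n -> R) (r : R) (x : 'rV[R]_n) i :
  tsupp h `<=` [set x | enorm x <= r] -> r < `|x 0 i| -> h x = 0.
Proof.
move=> hs xi; apply/eqP/negPn/negP => hx.
have /= : enorm x <= r by apply: hs; exact: subset_closure.
by apply/negP; rewrite -ltNge (lt_le_trans xi)// coord_le_enorm.
Qed.

Lemma iter_int_sum (L : R) (l : seq 'I_n) m (h : 'I_m -> Z -> R) : 0 < L ->
  (forall i, continuous (h i)) ->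
  iter_int L l (fun z => \sum_(i < m) h i z) =
  fun z => \sum_(i < m) iter_int L l (h i) z.
Proof.
move=> L0 ch; rewrite /index_enum -!enumT; elim: (enum 'I_m) => [|i s ih].
  under eq_fun do rewrite big_nil; apply/funext => z.
  by rewrite big_nil iter_int_cst// mul0r.
under eq_fun do rewrite big_cons.
rewrite iter_intD//; last exact: continuous_sumf.
by apply/funext => z; rewrite ih big_cons.
Qed.

End SpaceTimeDerivatives.

(** * Energy estimate: algebra *)

(** Energy cannot leave the cone faster than its lateral surface shrinks: this is
    Cauchy-Schwarz and 2 a b <= a^2 + b^2, obtained at once from the nonnegative sum
    of the squares (y_i P - D s g_i)^2. *)
Lemma energy_flux_le (R : realType) (m : nat) (y g : 'I_m -> R) (P s D : R) :
  0 < D -> \sum_(i < m) y i ^+ 2 <= D ^+ 2 ->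
  2 * s * P * \sum_(i < m) y i * g i <=
  D * (P ^+ 2 + s ^+ 2 * \sum_(i < m) g i ^+ 2).
Proof.
move=> D0 yD; rewrite -(ler_pM2l D0).
have : 0 <= \sum_(i < m) (y i * P - D * s * g i) ^+ 2.
  by apply: sumr_ge0 => i _; exact: sqr_ge0.
have -> : \sum_(i < m) (y i * P - D * s * g i) ^+ 2 =
    P ^+ 2 * \sum_(i < m) y i ^+ 2 - 2 * D * s * P * (\sum_(i < m) y i * g i) +
    (D * s) ^+ 2 * \sum_(i < m) g i ^+ 2.
  rewrite !mulr_sumr -sumrN -!big_split/=; apply: eq_bigr => i _; ring.
have : P ^+ 2 * \sum_(i < m) y i ^+ 2 <= P ^+ 2 * D ^+ 2.
  by rewrite ler_wpM2l// sqr_ge0.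
set X := \sum_(i < m) y i ^+ 2; set Y := \sum_(i < m) y i * g i.
set G := \sum_(i < m) g i ^+ 2; move: X Y G => X Y G h1 h2.
lra.
Qed.

(** The pointwise energy estimate.  P and Q stand for u_t and u_tt, s for the speed
    and ds for its derivative, w for the height of the weight, D for the radius of the
    cone, c for the damping coefficient mu / t, N for the source |grad u|^p, G2 for
    |grad u|^2, and SY, SG, SH for (x - x0) . grad u, grad u . grad u_t and the
    Laplacian.  The left-hand side is the time derivative of the weighted density minus
    the divergence of 2 s^2 w^2 u_t grad u.  The terms with SG and SH cancel; the damping
    and the decay of s have a favourable sign; the derivative of the weight
    compensates the flux; only the source remains, and it is bounded by the density
    because N <= M1 |grad u|. *)
Lemma energy_density_rate_le (R : realType) (w P Q s ds D c N M1 B SY SG SH G2 : R) :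
  Q = s ^+ 2 * SH - c * P + N ->
  0 <= w -> (0 < w -> 2 * s * P * SY <= D * (P ^+ 2 + s ^+ 2 * G2)) ->
  0 <= s -> ds <= 0 -> 0 <= c -> 0 <= G2 -> 0 <= N -> 0 <= M1 ->
  N <= M1 * Num.sqrt G2 -> 1 <= B * s ^+ 2 -> 1 <= B ->
  w ^+ 2 * (2 * P * Q +
            (s ^+ 2 * (2 * SG) + 2 * s * ds * G2)) +
    2 * w * (2 * D * - s) * (P ^+ 2 + s ^+ 2 * G2) -
  2 * s ^+ 2 * (- 4 * w * P * SY + w ^+ 2 * SG + w ^+ 2 * P * SH)
  <= M1 * B * (w ^+ 2 * (P ^+ 2 + s ^+ 2 * G2)).
Proof.
move=> -> w0 flux s0 ds0 c0 G0 N0 M0 NM Bs B1.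
have flux' : 0 <= w * s * (D * (P ^+ 2 + s ^+ 2 * G2) - 2 * s * P * SY).
  move: w0; rewrite le_eqVlt => /predU1P[<-|w0]; first by rewrite !mul0r.
  by rewrite !mulr_ge0 ?subr_ge0 ?flux// ltW.
have damp : 0 <= w ^+ 2 * (c * P ^+ 2) by rewrite mulr_ge0 ?sqr_ge0// mulr_ge0 ?sqr_ge0.
have decay : 0 <= w ^+ 2 * (s * - ds * G2).
  apply: mulr_ge0; first exact: sqr_ge0.
  by apply: mulr_ge0 => //; apply: mulr_ge0 => //; rewrite oppr_ge0.
have source : 2 * P * N <= M1 * B * (P ^+ 2 + s ^+ 2 * G2).
  set q := Num.sqrt G2 in NM.
  have q0 : 0 <= q by exact: sqrtr_ge0.
  have qE : G2 = q ^+ 2 by rewrite sqr_sqrtr.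
  have h1 : 2 * P * N <= M1 * (P ^+ 2 + q ^+ 2).
    apply: (@le_trans _ _ (2 * `|P| * (M1 * q))).
      apply: (@le_trans _ _ (2 * `|P| * N)).
        by rewrite -!mulrA ler_pM2l// ler_wpM2r// ler_norm.
      by rewrite ler_wpM2l// mulr_ge0.
    rewrite -(real_normK (num_real P)).
    have : 0 <= M1 * (`|P| - q) ^+ 2 by rewrite mulr_ge0 ?sqr_ge0.
    lra.
  apply: le_trans h1 _; rewrite -mulrA ler_wpM2l// mulrDr lerD//.
    by rewrite ler_peMl ?sqr_ge0.
  by rewrite -qE mulrA ler_peMl.
have : w ^+ 2 * (2 * P * N) <= w ^+ 2 * (M1 * B * (P ^+ 2 + s ^+ 2 * G2)).
  by rewrite ler_wpM2l ?sqr_ge0.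
lra.
Qed.

(** The distance covered between the times 1 and t at the speed t^(-alpha). *)
Definition sound_horizon (R : realType) (alpha t : R) : R :=
  (1 - alpha)^-1 * (t `^ (1 - alpha) - 1).

Lemma is_derive_sound_horizon (R : realType) (alpha t : R) : alpha < 1 -> 0 < t ->
  is_derive t (1 : R) (sound_horizon alpha) (t `^ (- alpha)).
Proof.
move=> a1 t0; apply: is_derive_eq (is_derive_cstM _
  (is_derive_subf (is_derive1_powR (1 - alpha) t0) (is_derive_cst _ _ _))) _.
rewrite subr0 mulrA mulVf ?mul1r; last by rewrite gt_eqF//; lra.
by congr (_ `^ _); ring.
Qed.

Lemma sound_horizon_nondecreasing (R : realType) (alpha s t : R) :
  alpha < 1 -> 0 < s -> s <= t -> sound_horizon alpha s <= sound_horizon alpha t.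
Proof.
move=> a1 s0 st; rewrite /sound_horizon ler_pM2l ?invr_gt0 ?subr_gt0// lerB//.
by rewrite ge0_ler_powR// ?nnegrE; lra.
Qed.

Lemma sound_horizon1 (R : realType) (alpha : R) : sound_horizon alpha 1 = 0.
Proof. by rewrite /sound_horizon powR1 subrr mulr0. Qed.

(** * The equation for the extended solution *)

Section SolutionExtension.
Context {R : realType} {n : nat}.
Local Notation Z := (R * 'rV[R]_n)%type.
Variables (alpha mu p eps b : R) (T : \bar R) (u0 u1 : 'rV[R]_n -> R)
  (u : R -> 'rV[R]_n -> R).
Hypotheses (b1 : 1 <= b) (bT : (b%:E < T)%E).
Hypothesis sol : classical_solution alpha mu p u0 u1 eps T u.

Local Notation time_slice := [set z : Z | 1 < z.1 < b].

Lemma open_time_slice : open time_slice.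
Proof.
rewrite openE => z /= /andP[z1 zb].
have cf : y.1 @[y --> z] --> z.1 by exact: cvg_fst.
have h1 : \forall y \near z, 1 < y.1 by exact: cf (lt_nbhsr z1).
have h2 : \forall y \near z, y.1 < b by exact: cf (lt_nbhsl zb).
by near=> y => /=; apply/andP; split; near: y.
Unshelve. all: by end_near. Qed.

Lemma time_slice_shift (z : Z) (s : R) i : time_slice z -> time_slice (z + s *: dx i).
Proof. by rewrite /= [s *: 0]mulr0 addr0. Qed.

Lemma solution_C2 : slab_Ck 2 T u.
Proof. have [h _ _ _] := sol; exact: h. Qed.

Lemma solution_time_C1 : slab_Ck 1 T (time_derive u).
Proof. have [_ _ _ h _] := solution_C2; exact: h. Qed.

Lemma solution_space_C1 i : slab_Ck 1 T (space_partial i u).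
Proof. have [_ _ _ _ h] := solution_C2; exact: h. Qed.

Lemma continuous_ext_C k (v : R -> 'rV[R]_n -> R) : slab_Ck k T v -> continuous (ext b v).
Proof. move=> vC; exact: (continuous_ext b1 bT (slab_Ck0 vC)). Qed.

Lemma ext_mixed_commute (z : Z) i : 1 < z.1 < b ->
  ext b (time_derive (space_partial i u)) z =
  ext b (space_partial i (time_derive u)) z.
Proof.
have [_ _ _ h1 h2] := solution_time_C1; have [_ _ _ h3 h4] := solution_space_C1 i.
move=> zb; apply: (@mixed_derivatives_commute _ _ time_slice (dx i) dt (ext b u)
  (ext b (space_partial i u)) (ext b (time_derive u))).
- exact: open_time_slice.
- by move=> y s; exact: time_slice_shift.
- exact: continuous_ext_C (solution_space_C1 i).
- exact: (@continuous_ext_C 0%N _ h3).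
- exact: (@continuous_ext_C 0%N _ (h2 i)).
- move=> y; exact: (is_derive_ext_space b1 bT _ _ solution_C2).
- move=> y yb; exact: (is_derive_ext_time bT solution_C2 yb).
- move=> y yb; exact: (is_derive_ext_time bT (solution_space_C1 i) yb).
- move=> y _; exact: (is_derive_ext_space b1 bT _ _ solution_time_C1).
- exact: zb.
Qed.

Lemma ext_equation (z : Z) : 1 < z.1 < b ->
  ext b (time_derive (time_derive u)) z =
  (z.1 `^ (- alpha)) ^+ 2 *
    (\sum_(i < n) ext b (space_partial i (space_partial i u)) z)
  - mu / z.1 * ext b (time_derive u) z
  + Num.sqrt (\sum_(i < n) ext b (space_partial i u) z ^+ 2) `^ p.
Proof.
case: z => t x /= /andP[t1 tb]; rewrite /ext/= !clamp_id ?(ltW t1) ?(ltW tb)//.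
case: sol => _ + _ _ => /(_ t x t1).
have -> : (t `^ (- alpha)) ^+ 2 = (t `^ (2 * alpha))^-1.
  by rewrite powRN exprVn -powR_mulrn ?powR_ge0// -powRrM mulrC.
have -> : enorm (gradient (u t) x) = Num.sqrt (\sum_(i < n) space_partial i u t x ^+ 2).
  by rewrite /enorm; congr Num.sqrt; apply: eq_bigr => i _; rewrite mxE.
rewrite /laplacian => <-; first by rewrite /space_partial; ring.
by apply: lt_trans bT; rewrite lte_fin.
Qed.

End SolutionExtension.

(** * The weight on a backward cone *)

Section ConeWeight.
Context {R : realType} {n : nat}.
Local Notation Z := (R * 'rV[R]_n)%type.
Variables (alpha b rho : R) (x0 : 'rV[R]_n).
Hypotheses (alpha0 : 0 <= alpha) (alpha1 : alpha < 1) (b1 : 1 <= b).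
Hypothesis rho_gt : sound_horizon alpha b < rho.

Definition speed (z : Z) : R := clamp b z.1 `^ (- alpha).

Definition cone_radius (z : Z) : R := rho - sound_horizon alpha (clamp b z.1).

Definition cone_gap (z : Z) : R :=
  cone_radius z ^+ 2 - \sum_(j < n) (z.2 0 j - x0 0 j) ^+ 2.

Definition cone_height (z : Z) : R := Num.max 0 (cone_gap z).

Lemma clamp_gt0 (t : R) : 0 < clamp b t.
Proof. by rewrite (lt_le_trans ltr01) ?clamp_ge1. Qed.

Lemma continuous_speed : continuous speed.
Proof. exact: continuous_powR_clamp. Qed.

Lemma speed_gt0 z : 0 < speed z.
Proof. by rewrite powR_gt0// clamp_gt0. Qed.

Lemma is_derive_speed z : 1 < z.1 < b ->
  is_derive z dt speed (- alpha * clamp b z.1 `^ (- alpha - 1)).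
Proof.
move=> zb; apply: (@is_derive_clamp_time _ _ (fun t => t `^ (- alpha))) => //.
rewrite clamp_id; last by lra.
by apply: is_derive1_powR; lra.
Qed.

Lemma continuous_cone_radius : continuous cone_radius.
Proof.
apply: continuous_subf; first exact: continuous_cst.
apply: continuous_mulf; first exact: continuous_cst.
by apply: continuous_subf; [exact: continuous_powR_clamp|exact: continuous_cst].
Qed.

Lemma cone_radius_gt0 z : 0 < cone_radius z.
Proof.
rewrite subr_gt0 (le_lt_trans _ rho_gt)//.
by apply: sound_horizon_nondecreasing => //; [exact: clamp_gt0|exact: clamp_le].
Qed.

Lemma cone_radius_le z : cone_radius z <= rho.
Proof.
rewrite /cone_radius gerBl -(sound_horizon1 alpha).
by apply: sound_horizon_nondecreasing => //; exact: clamp_ge1.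
Qed.

Lemma is_derive_cone_radius z : 1 < z.1 < b ->
  is_derive z dt cone_radius (- speed z).
Proof.
move=> zb; apply: is_derive_eq (is_derive_subf (is_derive_cst _ _ _)
  (is_derive_clamp_time zb (is_derive_sound_horizon alpha1 _))) _; first by lra.
by rewrite sub0r /speed clamp_id//; lra.
Qed.

Lemma continuous_cone_gap : continuous cone_gap.
Proof.
apply: continuous_subf; first by apply: continuous_expf; exact: continuous_cone_radius.
apply: continuous_sumf => j; apply: continuous_expf.
by apply: continuous_subf; [exact: continuous_coord|exact: continuous_cst].
Qed.

Lemma is_derive_cone_gap_time z : 1 < z.1 < b ->
  is_derive z dt cone_gap (2 * cone_radius z * - speed z).
Proof.
move=> zb; apply: is_derive_eq (is_derive_subf
  (is_derive_sqrf (is_derive_cone_radius zb))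
  (is_derive_sumf (fun j => is_derive_sqrf (is_derive_subf
     (is_derive_coord_time z j) (is_derive_cst (x0 0 j) z dt))))) _.
by rewrite subrr big1 ?subr0// => j _; rewrite mulr0.
Qed.

Lemma is_derive_cone_gap_space z i :
  is_derive z (dx i) cone_gap (- (2 * (z.2 0 i - x0 0 i))).
Proof.
apply: is_derive_eq (is_derive_subf
  (is_derive_time_space (fun t => (rho - sound_horizon alpha (clamp b t)) ^+ 2) z i)
  (is_derive_sumf (fun j => is_derive_sqrf (is_derive_subf
     (is_derive_coord_space z i j) (is_derive_cst (x0 0 j) z (dx i)))))) _.
rewrite sub0r (bigD1 i)//= eqxx subr0 mulr1 big1 ?addr0// => j /negPf ->.
by rewrite subr0 mulr0.
Qed.

Lemma continuous_cone_height : continuous cone_height.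
Proof.
move=> z; apply: (@continuous_max R _ (cst 0) cone_gap); first exact: cvg_cst.
exact: continuous_cone_gap.
Qed.

Lemma cone_height_ge0 z : 0 <= cone_height z.
Proof. by rewrite le_max lexx. Qed.

Lemma cone_height_gt0 z : 0 < cone_height z ->
  \sum_(j < n) (z.2 0 j - x0 0 j) ^+ 2 < cone_radius z ^+ 2.
Proof. by rewrite lt_max ltxx/= subr_gt0. Qed.

Lemma is_derive_weight_time z : 1 < z.1 < b ->
  is_derive z dt (fun z => cone_height z ^+ 2)
    (2 * cone_height z * (2 * cone_radius z * - speed z)).
Proof.
move=> zb; apply: is_derive_sqr_pos_part; first exact: continuous_cone_gap.
exact: is_derive_cone_gap_time.
Qed.

Lemma is_derive_weight_space z i :
  is_derive z (dx i) (fun z => cone_height z ^+ 2)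
    (2 * cone_height z * - (2 * (z.2 0 i - x0 0 i))).
Proof.
apply: is_derive_sqr_pos_part; first exact: continuous_cone_gap.
exact: is_derive_cone_gap_space.
Qed.

Lemma cone_height_eq0 (z : Z) i : `|z.2 0 i - x0 0 i| = rho -> cone_height z = 0.
Proof.
move=> zi; rewrite /cone_height max_l// subr_le0.
apply: (@le_trans _ _ (rho ^+ 2)).
  rewrite lerXn2r ?nnegrE ?cone_radius_le//; last first.
    exact: le_trans (ltW (cone_radius_gt0 z)) (cone_radius_le z).
  exact/ltW/cone_radius_gt0.
rewrite -zi real_normK ?num_real// (bigD1 i)//= lerDl.
by apply: sumr_ge0 => j _; exact: sqr_ge0.
Qed.

Lemma cone_height_center (t : R) : 0 < cone_height (t, x0).
Proof.
rewrite lt_max; apply/orP; right; rewrite subr_gt0 big1.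
  by rewrite exprn_gt0// cone_radius_gt0.
by move=> j _ /=; rewrite subrr expr0n.
Qed.

End ConeWeight.

(** * Energy estimate and finite propagation speed *)

Lemma energy_flux_partial_expand (R : comPzRingType) (W P g gt h y : R) :
  W ^+ 2 * (P * h + gt * g) + 2 * W * - (2 * y) * (P * g) =
  - 4 * W * P * (y * g) + W ^+ 2 * (g * gt) + W ^+ 2 * P * h.
Proof. ring. Qed.

Section ConeEnergy.
Context {R : realType} {n : nat}.
Local Notation Z := (R * 'rV[R]_n)%type.
Variables (alpha mu p eps b rho : R) (T : \bar R) (u0 u1 : 'rV[R]_n -> R)
  (u : R -> 'rV[R]_n -> R) (x0 : 'rV[R]_n).
Hypotheses (alpha0 : 0 <= alpha) (alpha1 : alpha < 1) (mu0 : 0 <= mu) (p1 : 1 < p).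
Hypotheses (b1 : 1 < b) (bT : (b%:E < T)%E).
Hypothesis rho_gt : sound_horizon alpha b < rho.
Hypothesis sol : classical_solution alpha mu p u0 u1 eps T u.

Local Notation w := (cone_height alpha b rho x0).
Local Notation s := (@speed R n alpha b).
Local Notation D := (@cone_radius R n alpha b rho).
Local Notation ut := (ext b (time_derive u)).
Local Notation utt := (ext b (time_derive (time_derive u))).
Local Notation ui i := (ext b (space_partial i u)).
Local Notation uti i := (ext b (space_partial i (time_derive u))).
Local Notation uit i := (ext b (time_derive (space_partial i u))).
Local Notation uii i := (ext b (space_partial i (space_partial i u))).

Definition grad_sqr (z : Z) : R := \sum_(i < n) ui i z ^+ 2.

Definition cone_energy (z : Z) : R := w z ^+ 2 * (ut z ^+ 2 + s z ^+ 2 * grad_sqr z).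

Definition cone_energy_rate (z : Z) : R :=
  w z ^+ 2 * (2 * ut z * utt z +
     (s z ^+ 2 * (2 * \sum_(i < n) ui i z * uit i z) +
      2 * s z * (- alpha * clamp b z.1 `^ (- alpha - 1)) * grad_sqr z)) +
  2 * w z * (2 * D z * - s z) * (ut z ^+ 2 + s z ^+ 2 * grad_sqr z).

Definition energy_flux i (z : Z) : R := w z ^+ 2 * (ut z * ui i z).

Definition energy_flux_partial i (z : Z) : R :=
  w z ^+ 2 * (ut z * uii i z + uti i z * ui i z) +
  2 * w z * - (2 * (z.2 0 i - x0 0 i)) * (ut z * ui i z).

Let b1' : 1 <= b := ltW b1.
Let cut : continuous ut := continuous_ext_C b1' bT (solution_time_C1 sol).
Let cui i : continuous (ui i) := continuous_ext_C b1' bT (solution_space_C1 sol i).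

Let cutt : continuous utt.
Proof.
have [_ _ _ h _] := solution_time_C1 sol.
exact: (@continuous_ext_C _ _ _ _ b1' bT 0%N _ h).
Qed.

Let cuti i : continuous (uti i).
Proof.
have [_ _ _ _ h] := solution_time_C1 sol.
exact: (@continuous_ext_C _ _ _ _ b1' bT 0%N _ (h i)).
Qed.

Let cuit i : continuous (uit i).
Proof.
have [_ _ _ h _] := solution_space_C1 sol i.
exact: (@continuous_ext_C _ _ _ _ b1' bT 0%N _ h).
Qed.

Let cuii i : continuous (uii i).
Proof.
have [_ _ _ _ h] := solution_space_C1 sol i.
exact: (@continuous_ext_C _ _ _ _ b1' bT 0%N _ (h i)).
Qed.

Let cw : continuous w := @continuous_cone_height _ _ alpha b rho x0.
Let cs : continuous s := @continuous_speed R n alpha b.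

Let cgrad_sqr : continuous grad_sqr.
Proof. by apply: continuous_sumf => i; apply: continuous_expf; exact: cui. Qed.

Let cdensity : continuous (fun z => ut z ^+ 2 + s z ^+ 2 * grad_sqr z).
Proof.
apply: continuous_addf; first by apply: continuous_expf; exact: cut.
apply: continuous_mulf; last exact: cgrad_sqr.
by apply: continuous_expf; exact: cs.
Qed.

Lemma continuous_cone_energy : continuous cone_energy.
Proof.
by apply: continuous_mulf; [apply: continuous_expf; exact: cw|exact: cdensity].
Qed.

Let crate : continuous cone_energy_rate.
Proof.
have c2 : continuous (fun _ : Z => 2 : R) by exact: continuous_cst.
apply: continuous_addf.
  apply: continuous_mulf; first by apply: continuous_expf; exact: cw.
  apply: continuous_addf.
    apply: continuous_mulf; last exact: cutt.
    by apply: continuous_mulf; [exact: c2|exact: cut].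
  apply: continuous_addf.
    apply: continuous_mulf; first by apply: continuous_expf; exact: cs.
    apply: continuous_mulf; first exact: c2.
    by apply: continuous_sumf => i; apply: continuous_mulf; [exact: cui|exact: cuit].
  apply: continuous_mulf; last exact: cgrad_sqr.
  apply: continuous_mulf; first by apply: continuous_mulf; [exact: c2|exact: cs].
  by apply: continuous_mulf; [exact: continuous_cst|exact: continuous_powR_clamp].
apply: continuous_mulf; last exact: cdensity.
apply: continuous_mulf; first by apply: continuous_mulf; [exact: c2|exact: cw].
apply: continuous_mulf.
  by apply: continuous_mulf; [exact: c2|exact: continuous_cone_radius].
have -> : (fun z : Z => - s z) = (fun z => (-1) * s z) by apply/funext => z; rewrite mulN1r.
by apply: continuous_mulf; [exact: continuous_cst|exact: cs].
Qed.

Let cflux i : continuous (energy_flux i).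
Proof.
apply: continuous_mulf; first by apply: continuous_expf; exact: cw.
by apply: continuous_mulf; [exact: cut|exact: cui].
Qed.

Let cfluxp i : continuous (energy_flux_partial i).
Proof.
apply: continuous_addf.
  apply: continuous_mulf; first by apply: continuous_expf; exact: cw.
  apply: continuous_addf; first by apply: continuous_mulf; [exact: cut|exact: cuii].
  by apply: continuous_mulf; [exact: cuti|exact: cui].
apply: continuous_mulf; last by apply: continuous_mulf; [exact: cut|exact: cui].
apply: continuous_mulf.
  by apply: continuous_mulf; [exact: continuous_cst|exact: cw].
have -> : (fun z : Z => - (2 * (z.2 0 i - x0 0 i))) =
    (fun z : Z => (-2) * (z.2 0 i - x0 0 i)) by apply/funext => z; rewrite mulNr.
apply: continuous_mulf; first exact: continuous_cst.
by apply: continuous_subf; [exact: continuous_coord|exact: continuous_cst].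
Qed.

Lemma is_derive_cone_energy z : 1 < z.1 < b ->
  is_derive z dt cone_energy (cone_energy_rate z).
Proof.
move=> zb.
have dut := is_derive_ext_time bT (solution_time_C1 sol) zb.
have dui i := is_derive_ext_time bT (solution_space_C1 sol i) zb.
apply: is_derive_eq (is_derive_mulf (is_derive_weight_time rho x0 alpha1 zb)
  (is_derive_addf (is_derive_sqrf dut)
    (is_derive_mulf (is_derive_sqrf (is_derive_speed alpha zb))
      (is_derive_sumf (fun i => is_derive_sqrf (dui i)))))) _.
rewrite /cone_energy_rate -/(grad_sqr z); congr (_ * (_ + (_ * _ + _)) + _).
by rewrite mulr_sumr; apply: eq_bigr => i _; rewrite mulrA.
Qed.

Lemma is_derive_energy_flux i z :
  is_derive z (dx i) (energy_flux i) (energy_flux_partial i z).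
Proof.
have dut := is_derive_ext_space b1' bT z i (solution_time_C1 sol).
have dui := is_derive_ext_space b1' bT z i (solution_space_C1 sol i).
exact: is_derive_mulf (is_derive_weight_space alpha b rho x0 z i) (is_derive_mulf dut dui).
Qed.

(** On the compact region 1 <= t <= b, |x_j - x0_j| <= rho the gradient is bounded by
    sqrt M, so |grad u|^p <= sqrt M^(p - 1) |grad u|; and s^(-2) = t^(2 alpha) is at most
    b^(2 alpha).  These two bounds make up K. *)
Lemma cone_energy_rate_le : exists2 K, 0 < K & forall z : Z, 1 < z.1 < b ->
  (forall j, `|z.2 0 j - x0 0 j| <= rho) ->
  cone_energy_rate z - 2 * s z ^+ 2 * \sum_(i < n) energy_flux_partial i z <=
  K * cone_energy z.
Proof.
have [M M0 gradM] := continuous_bounded_on_compact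
  (compact_setX (@segment_compact R 1 b)
    (@rV_compact R n (fun j => `[x0 0 j - rho, x0 0 j + rho]%classic)
      (fun j => @segment_compact R _ _))) cgrad_sqr.
have B1 : 1 <= b `^ (2 * alpha).
  by rewrite -[leLHS](powRr0 b); apply: (ler_powR b1'); rewrite mulr_ge0.
exists (Num.sqrt M `^ (p - 1) * b `^ (2 * alpha)).
  by rewrite mulr_gt0 ?powR_gt0 ?sqrtr_gt0// (lt_trans ltr01).
move=> z zb zx; have /andP[z1 zb'] := zb.
have z0 : 0 < z.1 := lt_trans ltr01 z1.
have zclamp : clamp b z.1 = z.1 by rewrite clamp_id// !ltW.
have sE : s z = z.1 `^ (- alpha) by rewrite /speed zclamp.
have G0 : 0 <= grad_sqr z by apply: sumr_ge0 => i _; exact: sqr_ge0.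
have GM : grad_sqr z <= M.
  rewrite -(ger0_norm G0); apply: gradM; split => /=.
    by rewrite in_itv/= !ltW.
  by move=> j; rewrite in_itv/=; have := zx j; rewrite ler_norml; lra.
have -> : \sum_(i < n) energy_flux_partial i z =
    - 4 * w z * ut z * (\sum_(i < n) (z.2 0 i - x0 0 i) * ui i z) +
    w z ^+ 2 * (\sum_(i < n) ui i z * uit i z) +
    w z ^+ 2 * ut z * (\sum_(i < n) uii i z).
  rewrite !mulr_sumr -!big_split/=; apply: eq_bigr => i _.
  rewrite (ext_mixed_commute b1' bT sol i zb).
  exact: energy_flux_partial_expand.
apply: (@energy_density_rate_le R (w z) (ut z) (utt z) (s z) _ (D z) (mu / z.1)
  (Num.sqrt (grad_sqr z) `^ p) _ _ _ _ (\sum_(i < n) uii i z) (grad_sqr z)).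
- rewrite sE; have eqn := ext_equation bT sol zb; exact: eqn.
- exact: cone_height_ge0.
- move=> /cone_height_gt0 wz; apply: energy_flux_le; last exact: ltW.
  exact: cone_radius_gt0.
- exact/ltW/speed_gt0.
- by rewrite mulNr oppr_le0 mulr_ge0// powR_ge0.
- by rewrite divr_ge0// ltW.
- exact: G0.
- exact: powR_ge0.
- exact: powR_ge0.
- have p0 : 0 < p := lt_trans ltr01 p1.
  rewrite -(mulr_powRB1 (sqrtr_ge0 _) p0) mulrC ler_wpM2r ?sqrtr_ge0//.
  by rewrite ge0_ler_powR ?nnegrE ?sqrtr_ge0 ?ler_wsqrtr// subr_ge0 ltW.
- have -> : s z ^+ 2 = (z.1 `^ (2 * alpha))^-1.
    by rewrite sE powRN exprVn -powR_mulrn ?powR_ge0// -powRrM mulrC.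
  rewrite ler_pdivlMr ?powR_gt0// mul1r.
  have b0 : 0 <= b := le_trans ler01 b1'.
  by rewrite ge0_ler_powR ?nnegrE ?mulr_ge0// ltW.
- exact: B1.
Qed.

(** Gronwall: the flux is zero on the faces of the box of half-side rho, since the
    weight vanishes there, so the integrated energy E satisfies E' <= K E and E = 0 at
    time 1.  Its integrand is then zero at the centre of the box. *)
Lemma cone_energy_eq0 : 0 < rho ->
  (forall x : 'rV[R]_n, 0 < w (1, x) -> ut (1, x) = 0 /\ forall i, ui i (1, x) = 0) ->
  forall t, 1 <= t -> t < b -> cone_energy (t, x0) = 0.
Proof.
move=> rho0 init t t1 tb.
pose E t := iter_int rho (enum 'I_n) cone_energy (t, x0).
pose E' t := iter_int rho (enum 'I_n) cone_energy_rate (t, x0).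
have cE : continuous E.
  apply: continuous_time_line; apply: continuous_iter_int => //.
  exact: continuous_cone_energy.
have dE y : 1 < y < b -> is_derive y (1 : R) E (E' y).
  move=> yb; apply: is_derive_time_line.
  apply: (@is_derive_iter_int _ _ [set z : Z | 1 < z.1 < b]) => //.
  - exact: continuous_cone_energy.
  - exact: open_time_slice.
  - by move=> z v i; exact: time_slice_shift.
  - by move=> z; exact: is_derive_cone_energy.
have [K K0 rateK] := cone_energy_rate_le.
have E'K y : 1 < y < b -> E' y <= K * E y.
  move=> yb; pose c := - (2 * s (y, x0) ^+ 2).
  have cc : continuous (fun z => c * \sum_(i < n) energy_flux_partial i z).
    apply: continuous_mulf; first exact: continuous_cst.
    by apply: continuous_sumf => i; exact: cfluxp.
  have -> : E' y = iter_int rho (enum 'I_n) (fun z => cone_energy_rate z +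
      c * \sum_(i < n) energy_flux_partial i z) (y, x0).
    rewrite iter_intD// iter_intZ//; last by apply: continuous_sumf => i; exact: cfluxp.
    rewrite iter_int_sum//; rewrite big1 ?mulr0 ?addr0// => i _.
    apply: (@iter_int_partial0 _ _ _ _ i (energy_flux i)) => //.
    - by rewrite mem_enum.
    - exact: enum_uniq.
    - by move=> z; exact: is_derive_energy_flux.
    - move=> z _ zi; rewrite /energy_flux (cone_height_eq0 alpha1 b1' rho_gt zi).
      by rewrite expr0n mul0r.
  have -> : K * E y = iter_int rho (enum 'I_n) (fun z => K * cone_energy z) (y, x0).
    by rewrite iter_intZ//; exact: continuous_cone_energy.
  apply: iter_int_le => //.
  - exact: enum_uniq.
  - by apply: continuous_addf; [exact: crate|exact: cc].
  - by apply: continuous_mulf; [exact: continuous_cst|exact: continuous_cone_energy].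
  - move=> z /= zy zx _; rewrite /c.
    have -> : s (y, x0) = s z by rewrite /speed zy.
    rewrite mulNr; apply: rateK; first by rewrite zy.
    by move=> j; apply: zx; rewrite mem_enum.
have E_ge0 y : 0 <= E y.
  rewrite -[0](_ : iter_int rho (enum 'I_n) (fun=> 0) (y, x0) = 0).
    apply: iter_int_le => //; [exact: enum_uniq|exact: continuous_cst| |].
      exact: continuous_cone_energy.
    move=> z _ _ _; rewrite mulr_ge0 ?sqr_ge0// addr_ge0 ?sqr_ge0//.
    by rewrite mulr_ge0 ?sqr_ge0// sumr_ge0// => i _; exact: sqr_ge0.
  by rewrite iter_int_cst// mul0r.
have E1 : E 1 = 0.
  rewrite -[RHS](_ : iter_int rho (enum 'I_n) (fun=> 0) (1, x0) = 0).
    apply: iter_int_eq => //; [exact: enum_uniq|exact: continuous_cone_energy| |].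
      exact: continuous_cst.
    move=> [y x] /= -> _ _; rewrite /cone_energy.
    have [/init[-> xi]|] := ltP 0 (w (1, x)).
      rewrite /grad_sqr big1; last by move=> i _; rewrite xi expr0n.
      by rewrite expr0n mulr0 addr0 mulr0.
    move=> w0; have -> : w (1, x) = 0 by apply/eqP; rewrite eq_le w0 cone_height_ge0.
    by rewrite expr0n mul0r.
  by rewrite iter_int_cst// mul0r.
have Et : E t = 0.
  have cexp : continuous (fun y => expR (- K * y)).
    apply: (@continuous_compf _ _ _ (fun y => - K * y) (@expR R)).
      by apply: continuous_mulf; [exact: continuous_cst|move=> ?; exact: cvg_id].
    exact: continuous_expR.
  have : - 1 * (E 1 * expR (- K * 1)) <= - 1 * (E t * expR (- K * t)).
    apply: (@ge0_derive_le _ (fun y => - 1 * (E y * expR (- K * y)))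
      (fun y => (K * E y - E' y) * expR (- K * y))) => //.
    - apply: continuous_mulf; first exact: continuous_cst.
      by apply: continuous_mulf.
    - move=> y /andP[y1 yt]; have yb : 1 < y < b by rewrite y1 (lt_trans yt).
      apply: is_derive_eq (is_derive_cstM (-1) (is_derive_mulf (dE y yb)
        (is_derive1_comp (is_derive_expR _) (is_derive_cstM (- K) (is_derive_id y 1))))) _.
      by rewrite /=; ring.
    - move=> y /andP[y1 yt]; have yb : 1 < y < b by rewrite y1 (lt_trans yt).
      by rewrite mulr_ge0 ?expR_ge0// subr_ge0 E'K.
  rewrite E1 mul0r mulr0 mulN1r oppr_ge0 pmulr_lle0 ?expR_gt0// => Et0.
  by apply/eqP; rewrite eq_le Et0 E_ge0.
apply: (iter_int_eq0 rho0 continuous_cone_energy) Et => z.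
rewrite mulr_ge0 ?sqr_ge0// addr_ge0 ?sqr_ge0//.
by rewrite mulr_ge0 ?sqr_ge0// sumr_ge0// => i _; exact: sqr_ge0.
Qed.

End ConeEnergy.

(** Take the cone with axis over x and initial radius |x_i| - r: its base misses the
    supports of the data, and it still contains x at time t.  Its energy is zero, so
    u_t vanishes at x up to the time t, and u(t, x) = u(1, x) = 0. *)
Lemma finite_propagation_speed (R : realType) (n : nat) (alpha mu p r eps t : R)
    (T : \bar R) (u0 u1 : 'rV[R]_n -> R) (u : R -> 'rV[R]_n -> R)
    (x : 'rV[R]_n) (i : 'I_n) :
  0 <= alpha -> alpha < 1 -> 0 <= mu -> 1 < p ->
  tsupp u0 `<=` [set x | enorm x <= r] -> tsupp u1 `<=` [set x | enorm x <= r] ->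
  classical_solution alpha mu p u0 u1 eps T u ->
  1 <= t -> (t%:E < T)%E -> r + sound_horizon alpha t < `|x 0 i| -> u t x = 0.
Proof.
move=> a0 a1 mu0 p1 s0 s1 sol t1 tT xi.
have [_ _ ic0 ic1] := sol.
have u0r y : r < `|(y : 'rV[R]_n) 0 i| -> u 1 y = 0.
  by move=> yr; rewrite ic0 (supported_eq0 s0 yr) mulr0.
have u1r y : r < `|(y : 'rV[R]_n) 0 i| -> time_derive u 1 y = 0.
  by move=> yr; rewrite ic1 (supported_eq0 s1 yr) mulr0.
have A0 : 0 <= sound_horizon alpha t.
  rewrite -(sound_horizon1 alpha); exact: sound_horizon_nondecreasing.
have xr : r < `|x 0 i| by lra.
move: t1; rewrite le_eqVlt => /predU1P[<-|t1]; first exact: u0r.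
pose rho := `|x 0 i| - r.
have rhot : sound_horizon alpha t < rho by rewrite /rho; lra.
have rho0 : 0 < rho by rewrite /rho; lra.
have clamp1 : clamp t 1 = 1 by rewrite clamp_id// lexx ltW.
have init (y : 'rV[R]_n) : 0 < cone_height alpha t rho x (1, y) ->
    ext t (time_derive u) (1, y) = 0 /\
    forall j, ext t (space_partial j u) (1, y) = 0.
  move=> /cone_height_gt0 /= yx.
  have yr : r < `|y 0 i|.
    have : (y 0 i - x 0 i) ^+ 2 < rho ^+ 2.
      apply: (@le_lt_trans _ _ (\sum_(j < n) (y 0 j - x 0 j) ^+ 2)).
        by rewrite (bigD1 i)//= lerDl sumr_ge0// => j _; exact: sqr_ge0.
      apply: lt_le_trans yx _; apply: lerXn2r; rewrite ?nnegrE ?(ltW rho0)//.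
        exact: (ltW (cone_radius_gt0 a1 (ltW t1) rhot _)).
      exact: (cone_radius_le t rho a1).
    rewrite -[ltLHS]real_normK ?num_real// ltr_pXn2r ?nnegrE ?(ltW rho0)//.
    have := ler_dist_dist (y 0 i) (x 0 i); rewrite /rho ler_norml; lra.
  split; first by rewrite /ext /= clamp1; exact: u1r.
  by move=> j; rewrite /ext /= clamp1; exact: (partial_eq0 j u0r yr).
have ut0 s : 1 < s < t -> ext t (time_derive u) (s, x) = 0.
  move=> /andP[s1' st].
  have := cone_energy_eq0 a0 a1 mu0 p1 t1 tT rhot sol rho0 init (ltW s1') st.
  move=> /eqP; rewrite /cone_energy mulf_eq0 expf_eq0/=.
  rewrite gt_eqF/=; last exact: cone_height_center a1 (ltW t1) rhot s.
  rewrite paddr_eq0 ?sqr_ge0//; first by rewrite expf_eq0/= => /andP[/eqP].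
  by rewrite mulr_ge0 ?sqr_ge0// sumr_ge0// => j _; exact: sqr_ge0.
have cU : continuous (fun s => ext t u (s, x)).
  exact/continuous_time_line/(continuous_ext_C (ltW t1) tT (solution_C2 sol)).
have dU s : 1 < s < t -> is_derive s (1 : R) (fun s => ext t u (s, x)) 0.
  move=> st; rewrite -(ut0 s st); apply: is_derive_time_line.
  exact: (is_derive_ext_time (z := (s, x)) tT (solution_C2 sol) st).
have le1 := @ge0_derive_le R (fun s => ext t u (s, x)) (fun=> 0) 1 t (ltW t1) cU
  dU (fun _ _ => lexx 0).
have cNU : continuous (fun s => -1 * ext t u (s, x)).
  by apply: continuous_mulf; [exact: continuous_cst|exact: cU].
have le2 := @ge0_derive_le R (fun s => -1 * ext t u (s, x)) (fun=> -1 * 0) 1 t (ltW t1)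
  cNU
  (fun s st => is_derive_cstM (-1) (dU s st)) (fun _ _ => ltac:(by rewrite mulr0)).
have e1 : ext t u (1, x) = 0 by rewrite /ext /= clamp1; exact: u0r.
have et : ext t u (t, x) = u t x by rewrite /ext /= clamp_id// lexx ltW.
move: le1 le2; rewrite e1 et !mulN1r oppr0 oppr_ge0 => l1 l2.
by apply/eqP; rewrite eq_le l1 l2.
Qed.

(** * The differential inequality for the spatial mean *)

(** G^p lies above its tangent at m.  Integrated with m proportional to the mean of G,
    this linear bound gives Jensen's inequality.  It is Young's inequality for the
    exponents p and p / (p - 1). *)
Lemma powR_tangent_le (R : realType) (p m G : R) : 1 < p -> 0 < m -> 0 <= G ->
  p * m `^ (p - 1) * G - (p - 1) * m `^ p <= G `^ p.
Proof.
move=> p1 m0 G0; have p0 : 0 < p by lra.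
have q0 : 0 < p / (p - 1) by rewrite divr_gt0//; lra.
have conj : p^-1 + (p / (p - 1))^-1 = 1.
  by rewrite invf_div; field; rewrite !gt_eqF//; lra.
have := conjugate_powR G0 (powR_ge0 m (p - 1)) p0 q0 conj.
rewrite -powRrM (_ : (p - 1) * (p / (p - 1)) = p); last first.
  by field; rewrite gt_eqF//; lra.
rewrite -(ler_pM2l p0) => h.
rewrite lerBlDr; apply: le_trans (_ : p * (G * m `^ (p - 1)) <= _).
  by rewrite (mulrC G) mulrA.
apply: le_trans h _; rewrite le_eqVlt; apply/orP; left; apply/eqP.
by field; rewrite !gt_eqF//; lra.
Qed.

Section MeanValue.
Context {R : realType} {n : nat}.
Local Notation Z := (R * 'rV[R]_n)%type.
Variables (alpha mu p r eps b : R) (T : \bar R) (u0 u1 : 'rV[R]_n -> R)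
  (u : R -> 'rV[R]_n -> R) (y : 'rV[R]_n) (i0 : 'I_n).
Hypotheses (alpha0 : 0 <= alpha) (alpha1 : alpha < 1) (mu0 : 0 <= mu) (p1 : 1 < p).
Hypotheses (r0 : 0 < r) (eps0 : 0 < eps) (b1 : 1 < b) (bT : (b%:E < T)%E).
Hypotheses (u0_supp : tsupp u0 `<=` [set x | enorm x <= r])
  (u1_supp : tsupp u1 `<=` [set x | enorm x <= r]).
Hypothesis sol : classical_solution alpha mu p u0 u1 eps T u.

(** Half the side of a box centred at y that contains the support of u(t, .) in its
    interior; the summand 1 leaves a margin, so that u and its derivatives vanish on
    the faces. *)
Definition box_size (t : R) : R := r + enorm y + 1 + sound_horizon alpha t.

Local Notation L := (box_size b).
Local Notation I f := (fun t : R => iter_int L (enum 'I_n) f (t, y)).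
Local Notation ut := (ext b (time_derive u)).
Local Notation utt := (ext b (time_derive (time_derive u))).
Local Notation ui i := (ext b (space_partial i u)).
Local Notation uii i := (ext b (space_partial i (space_partial i u))).

Let b1' : 1 <= b := ltW b1.

Let cU : continuous (ext b u) := continuous_ext_C b1' bT (solution_C2 sol).
Let cut : continuous ut := continuous_ext_C b1' bT (solution_time_C1 sol).
Let cui i : continuous (ui i) := continuous_ext_C b1' bT (solution_space_C1 sol i).

Let cutt : continuous utt.
Proof.
have [_ _ _ h _] := solution_time_C1 sol.
exact: (@continuous_ext_C _ _ _ _ b1' bT 0%N _ h).
Qed.

Let cuii i : continuous (uii i).
Proof.
have [_ _ _ _ h] := solution_space_C1 sol i.
exact: (@continuous_ext_C _ _ _ _ b1' bT 0%N _ (h i)).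
Qed.

Lemma box_size_gt0 t : 1 <= t -> 0 < box_size t.
Proof.
move=> t1; have : 0 <= enorm y by exact: sqrtr_ge0.
have : sound_horizon alpha 1 <= sound_horizon alpha t.
  exact: sound_horizon_nondecreasing.
by have := r0; rewrite sound_horizon1 /box_size; lra.
Qed.

Lemma box_size_le s t : 1 <= s -> s <= t -> box_size s <= box_size t.
Proof.
move=> s1 st; rewrite /box_size lerD2l sound_horizon_nondecreasing//.
exact: lt_le_trans s1.
Qed.

Let L0 : 0 < L := box_size_gt0 b1'.

Lemma outside_box (x : 'rV[R]_n) t j : box_size t <= `|x 0 j - y 0 j| ->
  r + sound_horizon alpha t < `|x 0 j|.
Proof.
have := coord_le_enorm y j; have := ler_normB (x 0 j) (y 0 j).
by rewrite /box_size; lra.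
Qed.

Lemma solution_eq0 (z : Z) j : 1 <= z.1 <= b ->
  box_size z.1 <= `|z.2 0 j - y 0 j| -> ext b u z = 0.
Proof.
case: z => t x /= tb /outside_box xj; rewrite /ext/= clamp_id//.
have /andP[t1 tb'] := tb.
apply: (finite_propagation_speed alpha0 alpha1 mu0 p1 u0_supp u1_supp sol t1 _ xj).
by apply: le_lt_trans bT; rewrite lee_fin.
Qed.

Lemma solution_partial_eq0 (z : Z) j k : 1 <= z.1 <= b ->
  box_size z.1 <= `|z.2 0 j - y 0 j| -> ui k z = 0.
Proof.
case: z => t x /= tb /outside_box xj; rewrite /ext/= clamp_id//.
have /andP[t1 tb'] := tb.
apply: (@partial_eq0 _ _ (u t) (r + sound_horizon alpha t) j) => // x' x'j.
apply: (finite_propagation_speed alpha0 alpha1 mu0 p1 u0_supp u1_supp sol t1 _ x'j).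
by apply: le_lt_trans bT; rewrite lee_fin.
Qed.

Lemma continuous_mean (f : Z -> R) : continuous f -> continuous (I f).
Proof. by move=> cf; apply/continuous_time_line/continuous_iter_int. Qed.

Lemma is_derive_mean (k : nat) (v : R -> 'rV[R]_n -> R) t : slab_Ck k.+1 T v ->
  continuous (ext b (time_derive v)) -> 1 < t < b ->
  is_derive t (1 : R) (I (ext b v)) (I (ext b (time_derive v)) t).
Proof.
move=> vC cv tb; apply: is_derive_time_line.
apply: (@is_derive_iter_int _ _ [set z : Z | 1 < z.1 < b] _ _ _ _ _ _ L0
  (continuous_ext_C b1' bT vC) cv (@open_time_slice _ _ b)) => //.
  by move=> z s i; exact: time_slice_shift.
move=> z zb; exact: (is_derive_ext_time bT vC zb).
Qed.

(** Integrating the equation over the box removes the Laplacian.  The function h is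
    u_tt + (mu / t) u_t - t^(-2 alpha) Lap u with the coefficients taken at the fixed
    time t: it is continuous on space-time, its integral splits term by term, and it
    equals |grad u|^p at time t. *)
Lemma mean_source t : 1 < t < b ->
  exists h : Z -> R, [/\ continuous h,
    forall z, z.1 = t -> h z = Num.sqrt (grad_sqr b u z) `^ p &
    I utt t + mu / t * I ut t = I h t].
Proof.
move=> tb; pose c := - ((t `^ (- alpha)) ^+ 2).
have clap : continuous (fun z => \sum_(i < n) uii i z).
  by apply: continuous_sumf => i; exact: cuii.
have c1 : continuous (fun z => mu / t * ut z).
  by apply: continuous_mulf; [exact: continuous_cst|exact: cut].
have c2 : continuous (fun z => c * \sum_(i < n) uii i z).
  by apply: continuous_mulf; [exact: continuous_cst|exact: clap].
have c3 : continuous (fun z => utt z + mu / t * ut z).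
  by apply: continuous_addf; [exact: cutt|exact: c1].
exists (fun z => utt z + mu / t * ut z + c * \sum_(i < n) uii i z); split.
- by apply: continuous_addf; [exact: c3|exact: c2].
- move=> z zt; have zb : 1 < z.1 < b by rewrite zt.
  have eqn := ext_equation bT sol zb; rewrite zt in eqn.
  rewrite eqn /c /grad_sqr; set A := Num.sqrt _ `^ p; move: A => A.
  by set B := \sum_(i < n) _; move: B => B; set C := ext _ _ _; move: C => C; ring.
- rewrite (iter_intD _ L0 c3 c2) (iter_intD _ L0 cutt c1) (iter_intZ _ _ L0 cut).
  rewrite (iter_intZ _ _ L0 clap) (iter_int_sum _ L0 (@cuii)).
  rewrite big1 ?mulr0 ?addr0// => i _.
  have ien : i \in enum 'I_n by rewrite mem_enum.
  apply: (iter_int_partial0 L0 ien (enum_uniq _) (@cui i) (@cuii i)).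
    by move=> z; exact: (is_derive_ext_space b1' bT z i (solution_space_C1 sol i)).
  move=> z /= zt zi; apply: (@solution_partial_eq0 _ i).
    by rewrite zt; case/andP: tb => /ltW -> /ltW ->.
  by rewrite zi box_size_le// zt; case/andP: tb => /ltW ? /ltW.
Qed.

Lemma mean_source_ge0 t : 1 < t < b -> 0 <= I utt t + mu / t * I ut t.
Proof.
move=> tb; have [h [ch hE ->]] := mean_source tb.
rewrite -[0](_ : iter_int L (enum 'I_n) (fun=> 0) (t, y) = 0); last first.
  by rewrite iter_int_cst// mul0r.
apply: iter_int_le => //; [exact: enum_uniq|exact: continuous_cst|].
by move=> z zt _ _; rewrite hE// powR_ge0.
Qed.

Lemma mean_initial : continuous u0 -> I (ext b u) 1 =
  eps * iter_int (box_size 1) (enum 'I_n) (fun z : Z => u0 z.2) (1, y).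
Proof.
move=> cu0; have [_ _ ic0 _] := sol.
have cz : continuous (fun z : Z => u0 z.2).
  by apply: continuous_compf cu0 => z; exact: cvg_snd.
have L1 : 0 < box_size 1 by exact: box_size_gt0.
rewrite (@iter_int_shrink _ _ (box_size 1)) ?enum_uniq ?box_size_le//.
  rewrite (@iter_int_eq _ _ _ _ _ (fun z : Z => eps * u0 z.2)) ?enum_uniq//.
  - by rewrite iter_intZ.
  - by apply: continuous_mulf; [exact: continuous_cst|exact: cz].
  - by move=> z z1 _ _; rewrite /ext z1 clamp_id ?lexx// ic0.
move=> z z1 [j _ zj]; apply: (@solution_eq0 _ j); rewrite z1 ?lexx//=.
exact: ltW.
Qed.

(** t^mu is an integrating factor: (t^mu F')' = t^mu (F'' + (mu / t) F') >= 0. *)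
Lemma mean_velocity_ge0 t : (forall x, 0 <= u1 x) -> 1 <= t <= b -> 0 <= I ut t.
Proof.
move=> u1_ge0 /andP[t1 tb]; have [_ _ _ ic1] := sol.
have I1 : 0 <= I ut 1.
  rewrite -[0](_ : iter_int L (enum 'I_n) (fun=> 0) (1, y) = 0); last first.
    by rewrite iter_int_cst// mul0r.
  apply: iter_int_le => //; [exact: enum_uniq|exact: continuous_cst|].
  move=> z z1 _ _; rewrite /ext z1 clamp_id ?lexx// ic1.
  by rewrite mulr_ge0// ltW.
have t0 : 0 < t := lt_le_trans ltr01 t1.
have ct s : 1 <= s <= b -> clamp b s = s by exact: clamp_id.
have : clamp b 1 `^ mu * I ut 1 <= clamp b t `^ mu * I ut t.
  apply: (@ge0_derive_le _ (fun s => clamp b s `^ mu * I ut s)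
    (fun s => s `^ mu * I utt s + (mu * s `^ (mu - 1)) * I ut s)) => //.
  - apply: continuous_mulf; last exact/continuous_mean/cut.
    apply: (@continuous_time_line _ _ (fun z : Z => clamp b z.1 `^ mu) y).
    exact: continuous_powR_clamp.
  - move=> s /andP[s1 st]; have sb : 1 < s < b by rewrite s1 (lt_le_trans st).
    have s0 : 0 < s := lt_trans ltr01 s1.
    apply: is_derive_eq (is_derive_mulf
      (is_derive_time_line (is_derive_clamp_time (z := (s, y)) sb
         (is_derive1_powR mu s0)))
      (is_derive_mean (solution_time_C1 sol) cutt sb)) _.
    by rewrite /= ct// !ltW//; case/andP: sb.
  - move=> s /andP[s1 st]; have sb : 1 < s < b by rewrite s1 (lt_le_trans st).
    have s0 : 0 < s := lt_trans ltr01 s1.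
    have -> : s `^ (mu - 1) = s `^ mu / s.
      by rewrite powRB ?powRr1 ?(ltW s0)// (gt_eqF s0) implybT.
    have -> : s `^ mu * I utt s + mu * (s `^ mu / s) * I ut s =
        s `^ mu * (I utt s + mu / s * I ut s) by ring.
    by rewrite mulr_ge0 ?powR_ge0// mean_source_ge0.
rewrite ct ?lexx// ct ?t1//= powR1 mul1r => h.
by rewrite -(pmulr_rge0 _ (powR_gt0 mu t0)) (le_trans I1).
Qed.

(** The tangent bound for |grad u|^p, together with |grad u| >= - (x_i - y_i) d_i u / l
    on the box of half-side l = box_size t; the integral of - (x_i - y_i) d_i u is the
    mean of u by parts.  The parameter m is free here and optimized afterwards. *)
Lemma mean_jensen t m : 1 < t < b -> 0 < m ->
  p * m `^ (p - 1) * (I (ext b u) t / box_size t)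
    - (p - 1) * m `^ p * (2 * box_size t) ^+ n <=
  I utt t + mu / t * I ut t.
Proof.
move=> tb m0; have [h [ch hE ->]] := mean_source tb.
have /andP[t1 tb'] := tb; have tb'' : 1 <= t <= b by rewrite !ltW.
set l := box_size t; have l0 : 0 < l by exact/box_size_gt0/ltW.
have lL : l <= L by rewrite box_size_le// ltW.
have p0 : 0 < p := lt_trans ltr01 p1.
have ux := enum_uniq 'I_n.
have hl : I h t = iter_int l (enum 'I_n) h (t, y).
  apply: iter_int_shrink => // z zt [j _ zj]; rewrite hE// /grad_sqr big1.
    by rewrite sqrtr0 powR0// gt_eqF.
  move=> k _; rewrite (@solution_partial_eq0 _ j)// ?expr0n//.
    by rewrite zt.
  by rewrite zt; exact: ltW.
have Ul : I (ext b u) t = iter_int l (enum 'I_n) (ext b u) (t, y).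
  apply: iter_int_shrink => // z zt [j _ zj]; apply: (@solution_eq0 _ j).
    by rewrite zt.
  by rewrite zt; exact: ltW.
have cx : continuous (fun z : Z => z.2 0 i0 - y 0 i0).
  by apply: continuous_subf; [exact: continuous_coord|exact: continuous_cst].
have cxu : continuous (fun z : Z => (z.2 0 i0 - y 0 i0) * ui i0 z).
  by apply: continuous_mulf; [exact: cx|exact: cui].
have parts : iter_int l (enum 'I_n) (fun z : Z => (z.2 0 i0 - y 0 i0) * ui i0 z) (t, y)
    = - I (ext b u) t.
  apply/eqP; rewrite -addr_eq0 Ul.
  have /(congr1 (@^~ (t, y))) /= <- := iter_intD (enum 'I_n) l0 cxu cU.
  apply/eqP; have ien : i0 \in enum 'I_n by rewrite mem_enum.
  apply: (iter_int_partial0 (g := fun z : Z => (z.2 0 i0 - y 0 i0) * ext b u z)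
    l0 ien ux).
  - by apply: continuous_mulf; [exact: cx|exact: cU].
  - by apply: continuous_addf; [exact: cxu|exact: cU].
  - move=> z; apply: is_derive_eq (is_derive_mulf
      (is_derive_subf (is_derive_coord_space z i0 i0) (is_derive_cst (y 0 i0) z (dx i0)))
      (is_derive_ext_space b1' bT z i0 (solution_C2 sol))) _.
    by rewrite eqxx subr0 mul1r.
  - move=> z zt zi; rewrite (@solution_eq0 _ i0) ?mulr0// zt//.
    by rewrite zi.
pose k1 := - (p * m `^ (p - 1) / l).
have c1 : continuous (fun z : Z => k1 * ((z.2 0 i0 - y 0 i0) * ui i0 z)).
  by apply: continuous_mulf; [exact: continuous_cst|exact: cxu].
have c2 : continuous (fun _ : Z => - ((p - 1) * m `^ p)) by exact: continuous_cst.
have lhsE : p * m `^ (p - 1) * (I (ext b u) t / l) - (p - 1) * m `^ p * (2 * l) ^+ n =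
  iter_int l (enum 'I_n) (fun z : Z => k1 * ((z.2 0 i0 - y 0 i0) * ui i0 z) +
     - ((p - 1) * m `^ p)) (t, y).
  rewrite (iter_intD _ l0 c1 c2) (iter_intZ _ _ l0 cxu) parts iter_int_cst//.
  by rewrite size_enum_ord /k1; set X := iter_int L _ _ _; ring.
rewrite lhsE hl; apply: iter_int_le => //.
  by apply: continuous_addf; [exact: c1|exact: c2].
move=> z zt zx _; rewrite hE//; set G := Num.sqrt _.
have G0 : 0 <= G by exact: sqrtr_ge0.
apply: le_trans (powR_tangent_le p1 m0 G0); rewrite lerD2r /k1 mulNr -mulrN.
rewrite -!mulrA ler_pM2l// ler_pM2l ?powR_gt0// ler_pdivrMl//.
have uiG : `|ui i0 z| <= G.
  rewrite -sqrtr_sqr ler_wsqrtr// /grad_sqr (bigD1 i0)//= lerDl.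
  by apply: sumr_ge0 => j _; exact: sqr_ge0.
apply: le_trans (ler_norm _) _; rewrite normrN normrM.
by apply: ler_pM => //; apply: zx; rewrite mem_enum.
Qed.

End MeanValue.

(** The maximizer m = F / (l V), with V = (2 l)^n the volume of the box, is the average
    that Jensen's inequality calls for; the bound becomes V (F / (l V))^p. *)
Lemma mean_constant (R : realType) (n : nat) (p F l : R) : 1 < p -> 0 < F -> 0 < l ->
  let m := F / (l * (2 * l) ^+ n) in
  p * m `^ (p - 1) * (F / l) - (p - 1) * m `^ p * (2 * l) ^+ n =
  2 `^ (- (n%:R * (p - 1))) * l `^ (- (p + n%:R * (p - 1))) * F `^ p.
Proof.
move=> p1 F0 l0 m; have p0 : 0 < p := lt_trans ltr01 p1.
have V0 : 0 < (2 * l) ^+ n by rewrite exprn_gt0// mulr_gt0.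
have m0 : 0 < m by rewrite divr_gt0// mulr_gt0.
have -> : F / l = m * (2 * l) ^+ n by rewrite /m; field; rewrite !gt_eqF.
have -> : p * m `^ (p - 1) * (m * (2 * l) ^+ n) = p * (m * m `^ (p - 1)) * (2 * l) ^+ n.
  by ring.
rewrite mulr_powRB1 ?(ltW m0)//.
transitivity (m `^ p * (2 * l) ^+ n); first by ring.
have [f Fe] : exists f, F = expR f by exists (ln F); rewrite lnK ?posrE.
have [k le] : exists k, l = expR k by exists (ln l); rewrite lnK ?posrE.
have [d de] : exists d, 2 = expR d :> R by exists (ln 2); rewrite lnK ?posrE.
rewrite /m de Fe le -expRD -expRM_natl -expRD -expRB !powR_expR -!expRD.
by congr expR; ring.
Qed.

Lemma box_size_growth (R : realType) (n : nat) (alpha r t : R) (y : 'rV[R]_n) :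
  alpha < 1 -> 0 < r -> 1 <= t ->
  box_size alpha r y t <= ((1 - alpha)^-1 + (r + enorm y + 1)) * t `^ (1 - alpha).
Proof.
move=> a1 r0 t1; have y0 : 0 <= enorm y by exact: sqrtr_ge0.
have ta1 : 1 <= t `^ (1 - alpha).
  by rewrite -[leLHS](powRr0 t) ler_powR// subr_ge0 ltW.
have ia : 0 < (1 - alpha)^-1 by rewrite invr_gt0 subr_gt0.
rewrite /box_size /sound_horizon.
have : 0 <= (r + enorm y + 1) * (t `^ (1 - alpha) - 1).
  by rewrite mulr_ge0 ?subr_ge0//; lra.
lra.
Qed.

(** The constants a and c depend neither on eps nor on T, u and b; this
    uniformity is what turns the blow-up time into a lifespan estimate.  The box is
    centred at a point y with u0 y != 0, which makes the integral a of u0 positive. *)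
Lemma spatial_mean_inequality (R : realType) (n : nat) (alpha mu p r : R)
    (u0 u1 : 'rV[R]_n -> R) (i0 : 'I_n) :
  0 <= alpha -> alpha < 1 -> 0 <= mu -> 1 < p -> 0 < r -> continuous u0 ->
  (forall x, 0 <= u0 x) -> (forall x, 0 <= u1 x) -> (exists x, u0 x != 0) ->
  tsupp u0 `<=` [set x | enorm x <= r] -> tsupp u1 `<=` [set x | enorm x <= r] ->
  exists a c, [/\ 0 < a, 0 < c &
    forall eps T u b, 0 < eps -> 1 < b -> (b%:E < T)%E ->
      classical_solution alpha mu p u0 u1 eps T u ->
    exists F F1 F2 : R -> R,
      [/\ [/\ continuous F, continuous F1 & F 1 = eps * a],
          forall t, 1 < t < b -> is_derive t (1 : R) F (F1 t),
          forall t, 1 < t < b -> is_derive t (1 : R) F1 (F2 t),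
          forall t, 1 <= t <= b -> 0 <= F1 t &
          forall t, 1 < t < b ->
            c * t `^ (- ((n%:R * (p - 1) + p) * (1 - alpha))) * F t `^ p <=
            F2 t + mu / t * F1 t]].
Proof.
move=> a0 a1 mu0 p1 r0 cu0 u0_ge0 u1_ge0 [y u0y] s0 s1.
have y0 : 0 <= enorm y by exact: sqrtr_ge0.
pose e := p + n%:R * (p - 1).
have e0 : 0 < e.
  by rewrite ltr_pwDl ?mulr_ge0 ?subr_ge0 ?(ltW p1)//; apply: lt_trans p1.
pose Cl := (1 - alpha)^-1 + (r + enorm y + 1).
have Cl0 : 0 < Cl by rewrite addr_gt0 ?invr_gt0 ?subr_gt0//; lra.
pose a := iter_int (box_size alpha r y 1) (enum 'I_n)
  (fun z : R * 'rV[R]_n => u0 z.2) (1, y).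
have L1 : 0 < box_size alpha r y 1 by exact: box_size_gt0.
have cz : continuous (fun z : R * 'rV[R]_n => u0 z.2).
  by apply: continuous_compf cu0 => z; exact: cvg_snd.
have a_gt0 : 0 < a.
  rewrite lt_neqAle; apply/andP; split.
    apply: contraNneq u0y => /esym h; apply/eqP.
    exact: (iter_int_eq0 L1 cz (fun z => u0_ge0 z.2) h).
  rewrite -[0](_ : iter_int (box_size alpha r y 1) (enum 'I_n) (fun=> 0) (1, y) = 0).
    by apply: iter_int_le => //; [exact: enum_uniq|exact: continuous_cst].
  by rewrite iter_int_cst// mul0r.
exists a, (2 `^ (- (n%:R * (p - 1))) * Cl `^ (- e)); split=> //.
  by rewrite mulr_gt0 ?powR_gt0.
move=> eps T u b eps0 b1 bT sol.
pose L := box_size alpha r y b.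
pose I f t := iter_int L (enum 'I_n) f (t, y).
have L0 : 0 < L by apply: box_size_gt0 => //; exact: ltW.
have cU := continuous_ext_C (ltW b1) bT (solution_C2 sol).
have cut := continuous_ext_C (ltW b1) bT (solution_time_C1 sol).
have cutt : continuous (ext b (time_derive (time_derive u))).
  have [_ _ _ h _] := solution_time_C1 sol.
  exact: (@continuous_ext_C _ _ _ _ (ltW b1) bT 0%N _ h).
have dF t : 1 < t < b ->
    is_derive t (1 : R) (I (ext b u)) (I (ext b (time_derive u)) t).
  exact: (is_derive_mean y a1 r0 b1 bT (solution_C2 sol) cut).
have F1_ge0 t : 1 <= t <= b -> 0 <= I (ext b (time_derive u)) t.
  exact: (mean_velocity_ge0 y a0 a1 mu0 p1 r0 eps0 b1 bT s0 s1 sol u1_ge0).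
have cF : continuous (I (ext b u)) by apply: continuous_mean => //; exact: ltW.
have FI : I (ext b u) 1 = eps * a.
  exact: (mean_initial y a0 a1 mu0 p1 r0 b1 bT s0 s1 sol cu0).
exists (I (ext b u)), (I (ext b (time_derive u))),
  (I (ext b (time_derive (time_derive u)))); split.
- by split; [exact: cF|apply: continuous_mean => //; exact: ltW|exact: FI].
- exact: dF.
- move=> t; exact: (is_derive_mean y a1 r0 b1 bT (solution_time_C1 sol) cutt).
- exact: F1_ge0.
- move=> t tb; have /andP[t1 tb'] := tb.
  have t0 : 0 < t := lt_trans ltr01 t1.
  have F_gt0 : 0 < I (ext b u) t.
    apply: (@lt_le_trans _ _ (eps * a)); first by rewrite mulr_gt0.
    rewrite -FI; apply: (@ge0_derive_le _ _ (I (ext b (time_derive u)))) => //.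
    + exact: ltW.
    + by move=> x /andP[x1 xt]; apply: dF; rewrite x1 (lt_trans xt).
    + by move=> x /andP[x1 xt]; apply: F1_ge0; rewrite !ltW// (lt_trans xt).
  have l0 : 0 < box_size alpha r y t by apply: box_size_gt0 => //; exact: ltW.
  have m0 : 0 < I (ext b u) t /
      (box_size alpha r y t * (2 * box_size alpha r y t) ^+ n).
    by rewrite divr_gt0// mulr_gt0// exprn_gt0// mulr_gt0.
  have := mean_jensen y i0 a0 a1 mu0 p1 r0 b1 bT s0 s1 sol tb m0.
  rewrite (mean_constant n p1 F_gt0 l0); apply: le_trans.
  rewrite ler_wpM2r ?powR_ge0// -mulrA ler_wpM2l ?powR_ge0//.
  have -> : - ((n%:R * (p - 1) + p) * (1 - alpha)) = (1 - alpha) * - e.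
    by rewrite /e; ring.
  rewrite powRrM -powRM ?powR_ge0 ?(ltW Cl0)// !powRN -/e.
  rewrite lef_pV2 ?posrE ?powR_gt0 ?mulr_gt0 ?powR_gt0//.
  rewrite ge0_ler_powR ?nnegrE ?(ltW e0) ?(ltW l0)//.
    by rewrite mulr_ge0 ?powR_ge0 ?(ltW Cl0).
  by apply: box_size_growth => //; exact: ltW.
Qed.

(** * Bounds on the lifespan *)

(** Here s0 is the logarithmic time from which blow-up is estimated; at s0 the mean is
    still bounded below by its initial value eps a, since it is nondecreasing.  Then
    k f^(p - 1) is a constant times eps^(p - 1) e^(delta s0) = g^(-2), so the doubling
    radius of [solution_doubles] is a multiple of g. *)
Lemma existence_time_bound (R : realType) (n : nat) (alpha mu p r : R)
    (u0 u1 : 'rV[R]_n -> R) :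
  (0 < n)%N ->
  0 <= alpha -> alpha < 1 -> 0 <= mu -> 1 < p -> 0 < r -> continuous u0 ->
  (forall x, 0 <= u0 x) -> (forall x, 0 <= u1 x) -> (exists x, u0 x != 0) ->
  tsupp u0 `<=` [set x | enorm x <= r] -> tsupp u1 `<=` [set x | enorm x <= r] ->
  let delta := 2 - (n%:R * (p - 1) + p) * (1 - alpha) in
  0 <= delta ->
  exists k1 k2, [/\ 0 < k1, 0 < k2 & forall eps T u kappa s0,
    0 < eps -> classical_solution alpha mu p u0 u1 eps T u ->
    0 <= kappa -> mu - 1 <= kappa -> 0 <= s0 ->
    forall g, g = eps `^ (- ((p - 1) / 2)) * expR (- (delta * s0 / 2)) ->
    (T <= (expR (s0 + (k1 * g + k2 * kappa * g ^+ 2)))%:E)%E].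
Proof.
move=> n0 a0 a1 mu0 p1 r0 cu0 u0_ge0 u1_ge0 u0_nt s0 s1 delta delta0.
have [a [c [a_gt0 c_gt0 mean]]] := spatial_mean_inequality (Ordinal n0)
  a0 a1 mu0 p1 r0 cu0 u0_ge0 u1_ge0 u0_nt s0 s1.
pose theta : R := 2 `^ (- ((p - 1) / 2)).
have theta01 : 0 < theta < 1.
  have d0 : 0 < ln 2 :> R by rewrite ln_gt0 ?ltr1n.
  have -> : theta = expR (- ((p - 1) / 2) * ln 2) by rewrite -powR_expR lnK ?posrE.
  rewrite expR_gt0/= -[ltRHS]expR0 ltr_expR mulNr oppr_lt0.
  by rewrite mulr_gt0// divr_gt0 ?subr_gt0.
have thetaE : 2 `^ (p - 1) * theta ^+ 2 = 1.
  rewrite /theta -powR_mulrn ?powR_ge0// -powRrM -powRD; last first.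
    by rewrite pnatr_eq0 implybT.
  by rewrite (_ : _ + _ = 0) ?powRr0//; field.
have th2 : 0 < 1 - theta ^+ 2 by nra.
(* r1 g solves k f^(p - 1) r^2 = 1 for k = c e^(delta s0) and f = eps a *)
pose r1 := (c * a `^ (p - 1)) `^ (- 2^-1).
have r1_gt0 : 0 < r1 by rewrite powR_gt0// mulr_gt0// powR_gt0.
exists (2 * r1 / (1 - theta)), (4 * r1 ^+ 2 / (1 - theta ^+ 2)); split.
- by rewrite divr_gt0// ?mulr_gt0// subr_gt0; case/andP: theta01.
- by rewrite divr_gt0// mulr_gt0// exprn_gt0.
move=> eps T u kappa t0 eps0 sol kappa0 muk t0_ge0 g gE.
have g0 : 0 < g by rewrite gE mulr_gt0 ?powR_gt0 ?expR_gt0.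
have -> : 2 * r1 / (1 - theta) * g + 4 * r1 ^+ 2 / (1 - theta ^+ 2) * kappa * g ^+ 2 =
    2 * (r1 * g) / (1 - theta) + 4 * kappa * (r1 * g) ^+ 2 / (1 - theta ^+ 2).
  by field; rewrite !gt_eqF//; lra.
set B := 2 * (r1 * g) / (1 - theta) + _.
rewrite leNgt; apply/negP => bT.
have B0 : 0 < B.
  rewrite ltr_wpDr//.
    by rewrite divr_ge0 ?(ltW th2)// mulr_ge0 ?sqr_ge0// mulr_ge0.
  by rewrite divr_gt0// ?subr_gt0 ?mulr_gt0//; case/andP: theta01.
have b1 : 1 < expR (t0 + B) by rewrite -expR0 ltr_expR; lra.
have [F [F1 [F2 [[cF cF1 F1E] dF dF1 F1_ge0 ode]]]] := mean eps T u _ eps0 b1 bT sol.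
suff : expR (t0 + B) < expR (t0 + B) by rewrite ltxx.
have q2 : (n%:R * (p - 1) + p) * (1 - alpha) <= 2 by rewrite -subr_ge0.
apply: (ode_blowup_bound p1 kappa0 muk c_gt0 q2 cF cF1 dF dF1 F1_ge0 ode t0_ge0 _
  theta01 thetaE (f := eps * a)).
- by rewrite ler_expR lerDl ltW.
- by rewrite mulr_gt0.
- by rewrite F1E.
- by rewrite mulr_gt0.
- rewrite -/delta /r1 gE.
  rewrite powRM ?(ltW eps0) ?(ltW a_gt0)//.
  have [e ee] : exists e, eps = expR e by exists (ln eps); rewrite lnK ?posrE.
  have [v ve] : exists v, c * a `^ (p - 1) = expR v.
    by exists (ln (c * a `^ (p - 1))); rewrite lnK ?posrE// mulr_gt0// powR_gt0.
  rewrite ve ee !powR_expR.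
  have -> : forall A B1 C D : R, c * A * (B1 * C) * D = (c * C) * A * B1 * D.
    by move=> *; ring.
  rewrite ve -!expRD -expRM_natl -!expRD -[RHS]expR0; congr expR; by field.
Qed.

Unset Implicit Arguments.
Set Strict Implicit.
Set Printing Implicit Defensive.

Theorem theorem3p7 (R : realType) (n : nat) (alpha mu p r : R)
    (u0 u1 : 'rV[R]_n -> R)
    (hn : (2 <= n)%N)
    (halpha0 : 0 <= alpha) (halpha1 : alpha < 1)
    (hmu : 0 <= mu)
    (hp1 : 1 < p) (hpF : p <= pF' n alpha)
    (hr : 0 < r)
    (hu0C : Ck 2 u0) (hu1C : Ck 1 u1)
    (hu0_ge0 : forall x, 0 <= u0 x) (hu1_ge0 : forall x, 0 <= u1 x)
    (hu0_nt : exists x, u0 x != 0) (hu1_nt : exists x, u1 x != 0)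
    (hu0_supp : tsupp u0 `<=` [set x | enorm x <= r])
    (hu1_supp : tsupp u1 `<=` [set x | enorm x <= r]) :
  (forall (eps : R) (T : \bar R) (u : R -> 'rV[R]_n -> R),
     0 < eps -> (1%:E < T)%E ->
     classical_solution alpha mu p u0 u1 eps T u -> (T < +oo)%E)
  /\
  (exists2 eps0 : R, 0 < eps0 & exists2 C : R, 0 < C &
     forall eps : R, 0 < eps -> eps <= eps0 ->
     [/\ p < pF' n alpha ->
           (lifespan alpha mu p u0 u1 eps <=
             (C * eps `^ (- ((p - 1) /
               (2 - (n%:R * (p - 1) + p) * (1 - alpha)))))%:E)%E,
         p = pF' n alpha -> mu <= 1 ->
           (lifespan alpha mu p u0 u1 eps <=
             (expR (C * eps `^ (- (p * (p - 1) / (p + 1)))))%:E)%E &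
         p = pF' n alpha -> 1 < mu ->
           (lifespan alpha mu p u0 u1 eps <=
             (expR (C * eps `^ (- (p - 1))))%:E)%E]).
Proof.
have n0 : (0 < n)%N := ltn_trans (isT : 0 < 1)%N hn.
have n10 : (0 : R) < n.+1%:R by rewrite ltr0n.
have a10 : 0 < 1 - alpha by rewrite subr_gt0.
pose delta := 2 - (n%:R * (p - 1) + p) * (1 - alpha).
(* delta = (n + 1) (1 - alpha) (pF' - p) *)
have deltaE : delta = n.+1%:R * (1 - alpha) * (pF' n alpha - p).
  rewrite /delta /pF' -natr1; field.
  by rewrite !gt_eqF//= natr1.
have delta0 : 0 <= delta.
  by rewrite deltaE !mulr_ge0 ?subr_ge0 ?ler0n ?(ltW halpha1).
have cu0 : continuous u0 by case: hu0C.
have [k1 [k2 [k10 k20 bound]]] := existence_time_bound n0 halpha0 halpha1 hmu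
  hp1 hr cu0 hu0_ge0 hu1_ge0 hu0_nt hu0_supp hu1_supp delta0.
pose kappa := Num.max 0 (mu - 1).
have kappa0 : 0 <= kappa by rewrite le_max lexx.
have muk : mu - 1 <= kappa by rewrite le_max lexx orbT.
split.
  move=> eps T u eps0 _ sol.
  exact: le_lt_trans (bound eps T u kappa 0 eps0 sol kappa0 muk (lexx 0) _ erefl) (ltry _).
(* one constant for the three cases: the factor exp (k1 + k2 kappa) of the power
   law also exceeds the exponent k1 + k2 kappa *)
pose C := expR (k1 + k2 * kappa).
have C_ge : k1 + k2 * kappa <= C by apply: le_trans (expR_ge1Dx _); rewrite lerDr.
have k2k : 0 <= k2 * kappa by rewrite mulr_ge0// ltW.
exists 1 => //; exists C; first exact: expR_gt0.
move=> eps eps0 eps1.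
have powle x y : x <= y -> eps `^ (- x) <= eps `^ (- y).
  by move=> xy; rewrite ger_powR ?eps0// lerN2.
split.
- move=> pF; apply: ge_ereal_sup => T [_ [u sol]].
  have d0 : 0 < delta by rewrite deltaE !mulr_gt0// subr_gt0.
  have s00 : 0 <= - ((p - 1) / delta * ln eps).
    by rewrite oppr_ge0 mulr_ge0_le0 ?ln_le0// divr_ge0 ?(ltW d0)// subr_ge0 ltW.
  (* s0 = - (p - 1) / delta * ln eps is the solution of g = 1 *)
  apply: le_trans (bound eps T u kappa _ eps0 sol kappa0 muk s00 1 _) _.
    have [e ee] : exists e, eps = expR e by exists (ln eps); rewrite lnK ?posrE.
    rewrite ee expRK powR_expR -expRD -[LHS]expR0; congr expR.
    by rewrite -/delta; field; rewrite gt_eqF.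
  rewrite lee_fin /C expRD expr1n !mulr1 mulrC ler_pM2l ?expR_gt0//.
  by rewrite -mulNr -powR_expR lnK ?posrE.
- move=> pF mu1; apply: ge_ereal_sup => T [_ [u sol]].
  have muk0 : mu - 1 <= 0 by rewrite subr_le0.
  apply: le_trans (bound eps T u 0 0 eps0 sol (lexx 0) muk0 (lexx 0) _ erefl) _.
  rewrite lee_fin ler_expR add0r !mulr0 !mul0r addr0 oppr0 expR0 mulr1.
  apply: ler_pM; rewrite ?(ltW k10) ?powR_ge0//; first lra.
  apply: powle; rewrite ler_pdivlMr; last lra.
  have : 0 <= (p - 1) * (p - 1) by rewrite mulr_ge0 ?subr_ge0 ?ltW.
  lra.
- move=> pF mu1; apply: ge_ereal_sup => T [_ [u sol]].
  apply: le_trans (bound eps T u kappa 0 eps0 sol kappa0 muk (lexx 0) _ erefl) _.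
  rewrite lee_fin ler_expR mulr0 mul0r oppr0 expR0 mulr1 add0r.
  have -> : (eps `^ (- ((p - 1) / 2))) ^+ 2 = eps `^ (- (p - 1)).
    by rewrite -powR_mulrn ?powR_ge0// -powRrM; congr (_ `^ _); field.
  apply: le_trans (_ : (k1 + k2 * kappa) * eps `^ (- (p - 1)) <= _); last first.
    by rewrite ler_wpM2r ?powR_ge0.
  rewrite [leRHS]mulrDl lerD2r ler_pM2l//; apply: powle; lra.
Qed.
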